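(* Let $f:\mathbb{R}^{n_x}\times\mathbb{R}\times\mathbb{R}\to\mathbb{R}^{n_x}$, $(x,\mu,u)\mapsto f(x,\mu,u)$, be continuously differentiable, and let $(x_{\mathrm{eq}},\mu_{\mathrm{eq}})\in\mathbb{R}^{n_x}\times\mathbb{R}$ satisfy $f(x_{\mathrm{eq}},\mu_{\mathrm{eq}},0)=0$. Let $$f_x=\partial_1f(x_{\mathrm{eq}},\mu_{\mathrm{eq}},0),\quad f_\mu=\partial_2f(x_{\mathrm{eq}},\mu_{\mathrm{eq}},0),\quad f_u=\partial_3f(x_{\mathrm{eq}},\mu_{\mathrm{eq}},0),$$ $$R_u=[f_u,f_xf_u,\ldots,f_x^{n_x-1}f_u]\in\mathbb{R}^{n_x\times n_x},\qquad R_\mu=[f_\mu,f_xf_\mu,\ldots,f_x^{n_x-1}f_\mu]\in\mathbb{R}^{n_x\times n_x}.$$ Let $\gamma>0$ be arbitrary. If the matrix pair $(R_\mu,f_xR_u)$ is regular, then there exist gains $K_{\mathrm{st},x}\in\mathbb{R}^{1\times n_x}$, $K_{\mathrm{st},\mu}\in\mathbb{R}$ and $a\in\mathbb{R}$ such that the following holds for the controlled system $$\dot x=f(x,\mu,au),\qquad\dot\mu=u,\qquad u=K_{\mathrm{st},x}(x_{\mathrm{ref}}-x)+K_{\mathrm{st},\mu}(\mu_{\mathrm{ref}}-\mu),$$ with constant reference values $(x_{\mathrm{ref}},\mu_{\mathrm{ref}})\in\mathbb{R}^{n_x}\times\mathbb{R}$: for every neighborhood $V$ of $(x_{\mathrm{eq}},\mu_{\mathrm{eq}})$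 there is a neighborhood $U$ of $(x_{\mathrm{eq}},\mu_{\mathrm{eq}})$ such that for all $(x_{\mathrm{ref}},\mu_{\mathrm{ref}})\in U$ the controlled system has a stable equilibrium $(x_{\mathrm{cn}},\mu_{\mathrm{cn}})\in V$ which is reached with local exponential decay rate greater than $\gamma$.
   Context: A pair $(A_0,A_1)$ of matrices in $\mathbb{R}^{n\times n}$ is called regular if the polynomial $\lambda\mapsto\det(A_0+\lambda A_1)$ is not identically zero. An equilibrium $z^*$ of an autonomous ODE $\dot z=F(z)$ is reached with local exponential decay rate greater than $\gamma$ if there exist $\gamma'>\gamma$, $C>0$ and $\delta>0$ such that every solution with $\|z(0)-z^*\|<\delta$ exists for all $t\ge0$ and satisfies $\|z(t)-z^*\|\le Ce^{-\gamma' t}\|z(0)-z^*\|$. Here $z=(x,\mu)$. *)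

(* Defs.v *)
From HB Require Import structures.
From mathcomp Require Export all_boot all_order all_algebra.
From mathcomp Require Export all_classical all_reals all_analysis.

Set Implicit Arguments.
Unset Strict Implicit.
Unset Printing Implicit Defensive.

Import Order.TTheory GRing.Theory Num.Theory.
Import numFieldNormedType.Exports.

Local Open Scope classical_set_scope.
Local Open Scope ring_scope.

Section C1.
Context {R : realType} {V W : normedModType R}.

(* The last clause is continuity of the differential for the operator norm. *)
Definition continuously_differentiable (f : V -> W) : Prop :=
  (forall p, differentiable f p) /\
  (forall p (eps : R), 0 < eps ->
     \forall q \near p, forall v, `|'d f q v - 'd f p v| <= eps * `|v|).

End C1.

Section PartialDerivatives.
Context {R : realType} {n : nat}.
Variable f : 'cV[R]_n -> R -> R -> 'cV[R]_n.

(* Acts on column vectors, hence not the library's ['J], which is the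
   transposed matrix acting on row vectors. *)
Definition partial1 (x : 'cV[R]_n) (mu u : R) : 'M[R]_n :=
  \matrix_(i, j) ('D_(delta_mx j 0) (fun y : 'cV[R]_n => f y mu u) x) i 0.

Definition partial2 (x : 'cV[R]_n) (mu u : R) : 'cV[R]_n :=
  derive1 (fun m : R => f x m u) mu.

Definition partial3 (x : 'cV[R]_n) (mu u : R) : 'cV[R]_n :=
  derive1 (fun w : R => f x mu w) u.

End PartialDerivatives.

Section MatrixNotions.
Context {R : realType} {n : nat}.

(* [b, A b, ..., A^(n-1) b] *)
Definition krylov_mx (A : 'M[R]_n) (b : 'cV[R]_n) : 'M[R]_n :=
  \matrix_(i, j) (A ^+ (j : nat) *m b) i 0.

Definition regular_pair (A0 A1 : 'M[R]_n) : Prop :=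
  ~ (forall lambda : R, \det (A0 + lambda *: A1) = 0).

End MatrixNotions.

Section AutonomousODE.
Context {R : realType} {E : normedModType R}.
Variable F : E -> E.

(* z solves z' = F z on [0, T[, with T possibly +oo; values of z outside
   [0, T[ are irrelevant. *)
Definition ode_solution (T : \bar R) (z : R -> E) : Prop :=
  [/\ (0 < T)%E,
      {within [set t : R | 0 <= t /\ (t%:E < T)%E], continuous z} &
      forall t : R, 0 < t -> (t%:E < T)%E -> is_derive t 1 z (F (z t))].

(* Every solution starting at z0 exists for all t >= 0: there is a global one,
   and every local one is the restriction of a global one. *)
Definition solutions_global (z0 : E) : Prop :=
  (exists2 z, ode_solution +oo%E z & z 0 = z0) /\
  (forall T z, ode_solution T z -> z 0 = z0 ->
     exists2 y, ode_solution +oo%E y &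
       forall t : R, 0 <= t -> (t%:E < T)%E -> y t = z t).

Definition equilibrium (zs : E) : Prop := F zs = 0.

(* Stability in the sense of Lyapunov. *)
Definition stable_equilibrium (zs : E) : Prop :=
  equilibrium zs /\
  forall eps : R, 0 < eps -> exists2 delta : R, 0 < delta &
    forall z0 : E, `|z0 - zs| < delta ->
      solutions_global z0 /\
      forall z, ode_solution +oo%E z -> z 0 = z0 ->
        forall t : R, 0 <= t -> `|z t - zs| < eps.

Definition reached_with_rate_gt (zs : E) (gamma : R) : Prop :=
  exists gamma' C delta : R,
    [/\ gamma < gamma', 0 < C, 0 < delta &
        forall z0 : E, `|z0 - zs| < delta ->
          solutions_global z0 /\
          forall z, ode_solution +oo%E z -> z 0 = z0 ->
            forall t : R, 0 <= t ->
              `|z t - zs| <= C * expR (- gamma' * t) * `|z 0 - zs|].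

End AutonomousODE.

Section ControlledSystem.
Context {R : realType} {n : nat}.
Variable f : 'cV[R]_n -> R -> R -> 'cV[R]_n.

Definition feedback (Kx : 'rV[R]_n) (Kmu : R) (ref z : 'cV[R]_n * R) : R :=
  (Kx *m (ref.1 - z.1)) 0 0 + Kmu * (ref.2 - z.2).

Definition controlled_system (Kx : 'rV[R]_n) (Kmu a : R)
    (ref z : 'cV[R]_n * R) : 'cV[R]_n * R :=
  (f z.1 z.2 (a * feedback Kx Kmu ref z), feedback Kx Kmu ref z).

End ControlledSystem.

(* Main.v *)
(* The augmented linearization is (A, B) with A = [0 0; fmu fx] and
   B = [1; a fu] (coordinates (mu, x)), whose Krylov matrix is block triangular
   with determinant det (Rmu + a fx Ru); regularity of the pair provides a gain
   a for which it is controllable. Pole placement then makes the closed-loop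
   linearization diagonalizable with distinct real eigenvalues at most
   - (gamma + 2). In modal coordinates the closed loop is, near the equilibrium
   and for all nearby references at once, a small Lipschitz perturbation of a
   negative diagonal system (strict differentiability of C^1 maps). Hence a
   Newton-like contraction yields an equilibrium, and the vector field is
   strongly dissipative for the Euclidean inner product around it, which gives
   at once exponential decay, uniqueness, and, with Picard iteration for a
   truncated field, global existence of solutions. *)
From HB Require Import structures.
Require Import Defs.
From mathcomp Require Import ring lra.
Set Implicit Arguments.
Unset Strict Implicit.
Unset Printing Implicit Defensive.
Import Order.TTheory GRing.Theory Num.Theory.
Import numFieldNormedType.Exports.
Local Open Scope classical_set_scope.
Local Open Scope ring_scope.

(** * Pole placement *)

(** Column [i] of the Krylov matrix is [A ^+ i *m B], so the matrix turns coefficient vectors into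
    values [q(A) B]. Once it is invertible, [q(A) B = 0] forces [q = 0] for polynomials of this
    size. *)
Lemma horner_mx_krylov (R : realType) n (A : 'M[R]_n.+1) (B : 'cV[R]_n.+1)
    (q : {poly R}) : (size q <= n.+1)%N ->
  horner_mx A q *m B = krylov_mx A B *m \col_i q`_i.
Proof.
move=> sq.
have -> : horner_mx A q = \sum_(i < n.+1) q`_i *: A ^+ i.
  rewrite -[in LHS](coefK q) poly_def rmorph_sum (big_ord_widen _ (fun i =>
    horner_mx A (q`_i *: 'X^i)) sq).
  rewrite big_mkcond; apply: eq_bigr => i _ /=.
  rewrite horner_mxZ rmorphXn /= horner_mx_X; case: ltnP => // qi.
  by rewrite nth_default // scale0r.
rewrite mulmx_suml; apply/matrixP => i j; rewrite ord1 summxE mxE.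
by apply: eq_bigr => k _; rewrite -scalemxAl !mxE mulrC.
Qed.

(* With [w_j = (A - lam_j)^-1 B] the requirement is just [K w_j = 1] for all
   [j]; a linear dependence between the [w_j] would, after clearing the
   resolvents, be a polynomial of degree [< n] killing [B]. *)
Lemma pole_placement (R : realType) n (A : 'M[R]_n.+1) (B : 'cV[R]_n.+1)
    (lam : 'I_n.+1 -> R) :
  krylov_mx A B \in unitmx -> injective lam ->
  (forall i, A - (lam i)%:M \in unitmx) ->
  exists (K : 'rV[R]_n.+1) (W : 'M[R]_n.+1), W \in unitmx /\
    (A - B *m K) *m W = W *m diag_mx (\row_i lam i).
Proof.
move=> uK injl uA.
pose w j := invmx (A - (lam j)%:M) *m B.
have wE j : (A - (lam j)%:M) *m w j = B by rewrite mulKVmx.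
clearbody w.
pose W := \matrix_(i, j) w j i 0.
have uW : W \in unitmx.
  (* [det0P] yields a vector in the left kernel; after transposition, [v] is a linear dependence
     between the columns [w j]. *)
  rewrite unitmxE unitfE -det_tr; apply/det0P => -[v v0 vW].
  pose p j : {poly R} := \prod_(i | i != j) ('X - (lam i)%:P).
  pose P : {poly R} := \prod_i ('X - (lam i)%:P).
  have PE j : P = p j * ('X - (lam j)%:P) by rewrite /P (bigD1 j)//= mulrC.
  have sizep j : size (p j) = n.+1.
    have : size P = n.+2 by rewrite /P -big_enum size_prod_XsubC size_enum_ord.
    rewrite (PE j) size_Mmonic ?monicXsubC//; last first.
      by rewrite monic_neq0// monic_prod_XsubC.
    by rewrite size_XsubC addn2 /= => -[].
  pose q := \sum_j v 0 j *: p j.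
  have Wv : \sum_j v 0 j *: w j = 0.
    move/(congr1 trmx): vW; rewrite trmx_mul trmxK trmx0 => vW.
    rewrite -[RHS]vW; apply/colP => i; rewrite summxE mxE.
    by apply: eq_bigr => j _; rewrite !mxE mulrC.
  (* Multiplying by [P(A)] clears all resolvents at once: its factor at [lam j] turns [w j] into
     [B]. *)
  have pwB j : horner_mx A P *m w j = horner_mx A (p j) *m B.
    by rewrite (PE j) rmorphM /= rmorphB /= horner_mx_X horner_mx_C -mulmxA wE.
  have qB : horner_mx A q *m B = 0.
    transitivity (horner_mx A P *m (\sum_j v 0 j *: w j));
      last by rewrite Wv mulmx0.
    rewrite /q rmorph_sum mulmx_suml mulmx_sumr.
    by apply: eq_bigr => j _; rewrite /= horner_mxZ -scalemxAl -scalemxAr pwB.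
  have sq : (size q <= n.+1)%N.
    apply: (leq_trans (size_sum _ _ _)); apply/bigmax_leqP => j _.
    by rewrite (leq_trans (size_scale_leq _ _))// sizep.
  move: qB; rewrite horner_mx_krylov//.
  move/(congr1 (mulmx (invmx (krylov_mx A B)))).
  rewrite mulKmx// mulmx0 => /colP q0.
  have {q0} q0 : q = 0.
    apply/polyP => i; rewrite coef0; case: (ltnP i n.+1) => ni.
      by have := q0 (Ordinal ni); rewrite !mxE.
    by rewrite nth_default// (leq_trans sq).
  case/eqP: v0; apply/rowP => j; rewrite mxE; apply/eqP.
  (* Lagrange interpolation: at [lam j] every [p i] with [i != j] vanishes, while [p j] does not
     since [lam] is injective. *)
  have := congr1 (horner^~ (lam j)) q0; rewrite horner0 /q horner_sum.
  rewrite (bigD1 j)//=.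
  rewrite big1 ?addr0 => [|i ij]; last first.
    rewrite hornerZ /p horner_prod (bigD1 j) /= 1?eq_sym//.
    by rewrite hornerXsubC subrr mul0r mulr0.
  rewrite hornerZ => /eqP; rewrite mulf_eq0 => /orP[//|].
  rewrite /p horner_prod prodf_seq_eq0 => /hasP[i _ /andP[ij]].
  by rewrite hornerXsubC subr_eq0 (inj_eq injl) eq_sym (negbTE ij).
(* This [K] satisfies [K w_j = 1] for all [j], whence [(A - B K) w_j = A w_j - B = lam_j w_j]. *)
exists (const_mx 1 *m invmx W), W; split=> //.
rewrite mulmxBl -[in X in _ - X]mulmxA mulmxKV//.
apply/matrixP => i j; rewrite mul_mx_diag !mxE big_ord1 !mxE mulr1.
have wij : \sum_k A i k * w j k 0 - lam j * w j i 0 = B i 0.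
  by rewrite -[in RHS](wE j) mulmxBl mul_scalar_mx !mxE.
rewrite -wij (eq_bigr (fun k => A i k * w j k 0)); last first.
  by move=> k _; rewrite mxE.
by rewrite opprB addrC subrK mulrC.
Qed.

(** A singular shift makes [x] a root of the characteristic polynomial, and Cauchy's bound confines
    those roots. Poles placed far enough to the left thus avoid the spectrum of [A]. *)
Lemma shift_unitmx_ltr (R : realType) n (A : 'M[R]_n) :
  exists c : R, forall x, x < c -> A - x%:M \in unitmx.
Proof.
have [b hb] := Cauchy_root_bound (monic_neq0 (char_poly_monic A)).
exists (- b) => x xb; apply: contraT; rewrite unitmxE unitfE negbK.
move=> /det0P[v v0 vA].
have : eigenvalue A x.
  apply/eigenvalueP; exists v => //; apply/eqP.
  by rewrite -subr_eq0 -mul_mx_scalar -mulmxBr vA.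
rewrite eigenvalue_root_char => /hb; apply: contraTT => _.
by rewrite -ltNge -normrN (lt_le_trans _ (ler_norm _))// ltrNr.
Qed.

(** * Calculus along curves *)

Lemma is_derive_col (R : realType) N (z : R -> 'cV[R]_N) (t : R) (d : 'cV[R]_N) :
  is_derive t 1 z d <-> forall i, is_derive t 1 (fun s => z s i 0) (d i 0).
Proof.
split=> [[zt dz] i|zi].
  split; first by have /derivable_mxP := zt; exact.
  by rewrite -dz derive_mx// mxE.
have zt : derivable z t 1.
  by apply/derivable_mxP => i j; rewrite ord1; exact: ex_derive.
split=> //; rewrite derive_mx//; apply/colP => i; rewrite mxE.
exact: derive_val.
Qed.

Lemma within_continuous_coord (R : realType) N (A : set R) (z : R ->
  'cV[R]_N) i :
  {within A, continuous z} -> {within A, continuous (fun s => z s i 0)}.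
Proof.
move=> cz x; apply: (@continuous_comp (subspace A) _ _ z (fun v => v i 0)).
  exact: cz.
exact: coord_continuous.
Qed.

Lemma continuous_col (R : realType) N (z : R -> 'cV[R]_N) :
  (forall i, continuous (fun s => z s i 0)) -> continuous z.
Proof.
move=> cz t; apply/cvgrPdist_lt => e e0; near=> s.
rewrite /Num.Def.normr/= mx_normrE; apply/bigmax_ltP; split => //= -[i j] _.
rewrite (ord1 j) !mxE /=; move: i; near: s; apply: filter_forall => i.
by have /cvgrPdist_lt := cz i t; exact.
Unshelve. all: by end_near. Qed.

Lemma antiderivative_real (R : realType) (g : R -> R) : continuous g ->
  exists G : R -> R, [/\ continuous G, G 0 = 0 &
    forall t : R, 0 < t -> is_derive t 1 G (g t)].
Proof.
move=> cg; pose mu := @lebesgue_measure R.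
(* Integrating from [-1] makes [0] an interior point, so that [I] is differentiable, hence
   continuous, there too. *)
pose I (x : R) := (\int[mu]_(t in [set` `[-1, x]]) g t)%R.
have dI (x : R) : -1 < x -> is_derive x 1 I (g x).
  move=> x1; have [dIx Ix] : derivable I x 1 /\ derive1 I x = g x.
    apply: (@continuous_FTC1_closed _ g (-1) x (x + 1)) => //;
      first by rewrite ltrDl.
      apply: continuous_compact_integrable; first exact: segment_compact.
      exact: continuous_subspaceT.
    exact: cg.
  by split => //; rewrite -derive1E.
(* Freezing the primitive at negative times makes it continuous on the whole line and leaves its
   derivative at positive times unchanged. *)
exists (fun t : R => I (Num.max 0 t) - I 0); split.
- move=> t; apply: cvgB; last exact: cvg_cst.
  apply: (@cvg_comp _ _ _ (fun s : R => Num.max 0 s) I _ (nbhs (Num.max 0 t))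
    _).
    apply: (@continuous_max _ _ (cst 0) id); [exact: cst_continuous|exact:
      cvg_id].
  apply/differentiable_continuous/derivable1_diffP.
  have := dI (Num.max 0 t); case=> //.
  by rewrite (lt_le_trans _ (_ : 0 <= _)) ?le_max ?lexx// oppr_lt0.
- by rewrite maxxx subrr.
- move=> t t0; apply: (@near_eq_is_derive _ _ _ (fun s => I s - I 0)).
  + near=> s; rewrite max_r//; apply: ltW; near: s; exact: lt_nbhsr.
  + have dIt := dI t (lt_trans _ t0); rewrite -[g t]subr0.
    by apply: is_deriveB; apply: dIt; rewrite oppr_lt0.
Unshelve. all: by end_near. Qed.

Lemma antiderivative_col (R : realType) N (g : R -> 'cV[R]_N) : continuous g ->
  exists G : R -> 'cV[R]_N, [/\ continuous G, G 0 = 0 &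
    forall t : R, 0 < t -> is_derive t 1 G (g t)].
Proof.
move=> cg.
have cgi i : continuous (fun s => g s i 0).
  by move=> x; apply: (@continuous_comp _ _ _ g (fun v => v i 0));
    [exact: cg|exact: coord_continuous].
have [G HG] := choice (fun i => antiderivative_real (cgi i)).
exists (fun t => \col_i G i t); split.
- by apply: continuous_col => i; under eq_fun do rewrite mxE; have [] := HG i.
- by apply/colP => i; rewrite !mxE; have [] := HG i.
- move=> t t0; apply/is_derive_col => i; under eq_fun do rewrite mxE.
  by have [_ _] := HG i; exact.
Qed.

Lemma ge0_derive_le (R : realType) (h dh : R -> R) (a b : R) : a <= b ->
  {within `[a, b], continuous h} ->
  (forall s : R, a < s < b -> is_derive s 1 h (dh s) /\ 0 <= dh s) ->
  h a <= h b.
Proof.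
rewrite le_eqVlt => /predU1P[->//|ab] ch dhE.
have [s|s sab e] := MVT ab (df := dh) _ ch; first by rewrite in_itv/= => /dhE[].
rewrite -subr_ge0 e; apply: mulr_ge0; last by rewrite subr_ge0 ltW.
by move: sab; rewrite in_itv/= => /dhE[].
Qed.

Lemma norm_col_le (R : realType) N (v : 'cV[R]_N) (r : R) : 0 <= r ->
  `|v| <= r <-> forall i, `|v i 0| <= r.
Proof.
move=> r0; rewrite {1}/Num.Def.normr/= mx_normrE; split.
  move=> /bigmax_leP[_ h] i; exact: (h (i, 0)).
by move=> h; apply/bigmax_leP; split=> //= -[i j] _; rewrite (ord1 j) h.
Qed.

Lemma norm_coord_le (R : realType) N (v : 'cV[R]_N) i : `|v i 0| <= `|v|.
Proof. by have /norm_col_le := lexx `|v|; exact. Qed.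

(** For each coordinate [i], both [h + g_i] and [h - g_i] have nonnegative derivative, and the norm
    is the maximum over coordinates. *)
Lemma norm_increment_le (R : realType) N (g dg : R -> 'cV[R]_N) (h dh : R -> R)
    (a b : R) : a <= b ->
  {within `[a, b], continuous g} -> {within `[a, b], continuous h} ->
  (forall s : R, a < s < b -> is_derive s 1 g (dg s)) ->
  (forall s : R, a < s < b -> is_derive s 1 h (dh s)) ->
  (forall s : R, a < s < b -> `|dg s| <= dh s) ->
  `|g b - g a| <= h b - h a.
Proof.
move=> ab cg ch dgE dhE le_dg_dh.
have le_coord i : `|g b i 0 - g a i 0| <= h b - h a.
  have cgi := within_continuous_coord (i := i) cg.
  rewrite ler_norml; apply/andP; split.
    suff : g a i 0 + h a <= g b i 0 + h b by lra.
    apply: (@ge0_derive_le _ (fun s => g s i 0 + h s) (fun s => dg s i 0 + dh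
      s)) => //.
      by move=> x; apply: cvgD; [exact: cgi|exact: ch].
    move=> s sab; split.
      by apply: is_deriveD; [have /is_derive_col := dgE s sab;
        exact|exact: dhE].
    by have := le_trans (norm_coord_le (dg s) i) (le_dg_dh s sab);
      rewrite ler_norml; lra.
  suff : h a - g a i 0 <= h b - g b i 0 by lra.
  apply: (@ge0_derive_le _ (fun s => h s - g s i 0) (fun s => dh s - dg s i 0))
    => //.
    by move=> x; apply: cvgB; [exact: ch|exact: cgi].
  move=> s sab; split.
    by apply: is_deriveB; [exact: dhE|have /is_derive_col := dgE s sab; exact].
  by have := le_trans (norm_coord_le (dg s) i) (le_dg_dh s sab);
    rewrite ler_norml; lra.
(* For [N = 0] no coordinate shows that the bound is nonnegative; it is because [dh] dominates a
   norm. *)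
apply/norm_col_le => [|i]; last by rewrite !mxE.
rewrite subr_ge0; apply: (ge0_derive_le ab ch) => s sab.
by split; [exact: dhE|exact: le_trans (le_dg_dh s sab)].
Qed.

(** * ** Geometric convergence and Picard iteration *)

Lemma half_expn_small (R : realType) (D e : R) : 0 < e ->
  exists n, D / 2 ^+ n < e.
Proof.
move=> e0; have h1 : `|2^-1 : R| < 1 by rewrite ger0_norm ?invr_ge0//
  invf_lt1 ?ltr1n.
have /cvgrPdist_lt/(_ e e0)[n _ hn] := cvg_geometric D h1.
exists n; have := hn n (leqnn n); rewrite /= sub0r normrN exprVn.
exact/le_lt_trans/ler_norm.
Qed.

(** The telescoping series converges absolutely by comparison with a geometric one, whose tail is
    the stated error. *)
Lemma geometric_increments_cvg (R : realType) (X : completeNormedModType R)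
    (u : nat -> X) (c : R) :
  (forall n, `|u n.+1 - u n| <= c / 2 ^+ n) ->
  exists l, forall n, `|l - u n| <= 2 * c / 2 ^+ n.
Proof.
move=> hu.
have c0 : 0 <= c by have := le_trans (normr_ge0 _) (hu 0%N);
  rewrite expr0 divr1.
(* Keeping the exact remainder of the geometric sum, instead of dropping it, is what lets the
   induction on [m] close. *)
have incr n m : `|u (n + m)%N - u n| <= 2 * c / 2 ^+ n - 2 * c / 2 ^+ (n + m).
  elim: m => [|m IH]; first by rewrite addn0 !subrr normr0.
  rewrite addnS -(subrKA (u (n + m)%N)) (le_trans (ler_normD _ _))//.
  have := lerD (hu (n + m)%N) IH; move/le_trans; apply.
  by rewrite exprS invfM; lra.
have h1 : `|2^-1 : R| < 1 by rewrite ger0_norm ?invr_ge0// invf_lt1 ?ltr1n.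
have /normed_cvg cu : cvgn [normed series (telescope u)].
  apply: (@series_le_cvg _ (fun n => `|telescope u n|) (geometric c 2^-1)) =>
    //.
  - by move=> n; rewrite /geometric/= mulr_ge0// exprn_ge0// invr_ge0.
  - by move=> n; rewrite /geometric/= exprVn; exact: hu.
  - exact: is_cvg_geometric_series.
exists (u 0%N + limn (series (telescope u))) => n.
have ul : u m @[m --> \oo] --> u 0%N + limn (series (telescope u)).
  apply: cvg_trans (cvgD (cvg_cst (u 0%N)) cu).
  by apply: near_eq_cvg; apply: nearW => m; rewrite [RHS]eq_sum_telescope.
apply/ler_addgt0Pr => e e0; move/cvgrPdist_lt : ul => /(_ e e0)[m _ hm].
have := hm (n + m)%N (leq_addl _ _); have := incr n m.
set l := u 0%N + _ => um lm.
rewrite -(subrKA (u (n + m)%N)) (le_trans (ler_normD _ _))//.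
have : 0 <= 2 * c / 2 ^+ (n + m) by rewrite divr_ge0 ?mulr_ge0 ?exprn_ge0.
move: um (ltW lm); lra.
Qed.

Lemma geometric_increments_cvg_col (R : realType) N (u : nat ->
  'cV[R]_N) (c : R) :
  (forall n, `|u n.+1 - u n| <= c / 2 ^+ n) ->
  exists l, forall n, `|l - u n| <= 2 * c / 2 ^+ n.
Proof.
move=> hu.
have c0 : 0 <= c by have := le_trans (normr_ge0 _) (hu 0%N);
  rewrite expr0 divr1.
have ui i n : `|u n.+1 i 0 - u n i 0| <= c / 2 ^+ n.
  by have := le_trans (norm_coord_le _ i) (hu n); rewrite !mxE.
have [l hl] := choice (fun i => @geometric_increments_cvg _ R^o _ _ (ui i)).
exists (\col_i l i) => n; apply/norm_col_le => [|i]; last by rewrite !mxE;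
  exact: hl.
by rewrite divr_ge0 ?mulr_ge0 ?exprn_ge0.
Qed.

(** Comparison with [c * expR (K * t)], whose derivative is the assumed bound and whose value at [0]
    is nonnegative. It shows that integration gains a factor [1 / K] in the sup norm weighted by
    [expR (- K * t)]. *)
Lemma exp_growth (R : realType) N (g dg : R -> 'cV[R]_N) (c K t : R) :
  0 <= t -> 0 <= c -> continuous g -> g 0 = 0 ->
  (forall s : R, 0 < s -> is_derive s 1 g (dg s)) ->
  (forall s : R, 0 < s -> `|dg s| <= c * K * expR (K * s)) ->
  `|g t| <= c * expR (K * t).
Proof.
move=> t0 c0 cg g0 dgE dg_le.
have dexp (s : R) : is_derive s 1 (fun s : R => c * expR (K * s)) (c * K * expR
  (K * s)).
  by apply: is_derive_eq; rewrite /GRing.scale/=; ring.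
have := @norm_increment_le _ _ g dg (fun s => c * expR (K * s))
  (fun s => c * K * expR (K * s)) 0 t t0.
rewrite g0 subr0 mulr0 expR0 mulr1 => h.
apply: (@le_trans _ _ (c * expR (K * t) - c)); last by rewrite lerBlDr lerDl.
apply: h => //.
- exact: continuous_subspaceT.
- apply: continuous_subspaceT => s;
  apply/differentiable_continuous/derivable1_diffP.
  by have [] := dexp s.
- by move=> s /andP[s0 _]; exact: dgE.
- by move=> s /andP[s0 _]; exact: dg_le.
Qed.

(** In the exponentially weighted norm with [K = 2 * k] the Picard map halves distances, so its
    iterates converge on the whole half line at once, without gluing short time intervals. *)
Lemma lipschitz_global_solution (R : realType) N (H : 'cV[R]_N ->
  'cV[R]_N) (k : R) :
  0 < k -> (forall u v, `|H u - H v| <= k * `|u - v|) ->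
  forall z0, exists z : R -> 'cV[R]_N, [/\ continuous z, z 0 = z0 &
    forall t : R, 0 < t -> is_derive t 1 z (H (z t))].
Proof.
move=> k0 kH z0.
have cH : continuous H.
  move=> v; apply/(@cvgrPdist_lt _ _ _ (nbhs v) _) => e e0; near=> w.
  rewrite (le_lt_trans (kH _ _))// -ltr_pdivlMl//.
  near: w; have /cvgrPdist_lt := @cvg_id _ (nbhs v); apply.
  by rewrite mulr_gt0// invr_gt0.
have [Phi HPhi] : {Phi : (R -> 'cV[R]_N) -> R ->
  'cV[R]_N & forall y, continuous y ->
    [/\ continuous (Phi y), Phi y 0 = z0 &
      forall t : R, 0 < t -> is_derive t 1 (Phi y) (H (y t))]}.
  apply: (@choice _ _ (fun y w => continuous y -> [/\ continuous w, w 0 = z0 &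
      forall t : R, 0 < t -> is_derive t 1 w (H (y t))])) => y.
  have [cy|] := pselect (continuous y); last by exists y.
  have cHy : continuous (H \o y).
    by move=> t; apply: continuous_comp; [exact: cy|exact: cH].
  have [G [cG G0 dG]] := antiderivative_col cHy.
  exists (fun t => z0 + G t) => _; split.
  - by move=> t; apply: cvgD; [exact: cvg_cst|exact: cG].
  - by rewrite G0 addr0.
  - move=> t t0; rewrite -[H _]add0r.
    by apply: (@is_deriveD _ _ _ (cst z0)); exact: dG.
pose y n := iter n Phi (cst z0).
have cy n : continuous (y n).
  by elim: n => [t|n IH]; [exact: cvg_cst|have [] := HPhi _ IH].
have y0 n : y n.+1 0 = z0 by have [] := HPhi _ (cy n).
have dy n (t : R) : 0 < t -> is_derive t 1 (y n.+1) (H (y n t)).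
  by have [_ _] := HPhi _ (cy n); exact.
pose K := 2 * k; have K0 : 0 < K by rewrite mulr_gt0.
(* With this [c] the first increment, of derivative [H z0], satisfies the bound of [exp_growth], as
   [c * K] is the norm of [H z0]. *)
pose c := `|H z0| / K; have c0 : 0 <= c by rewrite divr_ge0// ltW.
have cn0 n : 0 <= c / 2 ^+ n by rewrite divr_ge0// exprn_ge0.
have yS n (t : R) : 0 <= t -> `|y n.+1 t - y n t| <= c * expR (K * t) / 2 ^+ n.
  elim: n t => [|n IH] t t0; rewrite [leRHS]mulrAC.
    apply: (@exp_growth _ _ (fun s => y 1%N s - z0) (fun=> H z0)) => //.
    - by move=> s; apply: cvgB; [exact: cy|exact: cvg_cst].
    - by rewrite y0 subrr.
    - move=> s s0; rewrite -[H z0]subr0.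
      by apply: (@is_deriveB _ _ _ _ (cst z0)); exact: dy.
    - move=> s s0; rewrite expr0 divr1 divfK ?gt_eqF// ler_peMr//.
      by rewrite -[leLHS]expR0 ler_expR mulr_ge0// ltW.
  apply: (@exp_growth _ _ (fun s => y n.+2 s - y n.+1 s)
    (fun s => H (y n.+1 s) - H (y n s))) => //.
  - by move=> s; apply: cvgB; exact: cy.
  - by rewrite !y0 subrr.
  - by move=> s s0; apply: is_deriveB; exact: dy.
  - move=> s s0; rewrite (le_trans (kH _ _))//.
    rewrite (le_trans (ler_wpM2l (ltW k0) (IH s (ltW s0))))//.
    by rewrite exprS invfM /K; lra.
have [Y HY] : {Y : R -> 'cV[R]_N & forall t n, 0 <= t ->
    `|Y t - y n t| <= 2 * (c * expR (K * t)) / 2 ^+ n}.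
  apply: (@choice _ _ (fun t l => forall n, 0 <= t ->
    `|l - y n t| <= 2 * (c * expR (K * t)) / 2 ^+ n)) => t.
  have [t0|t0] := leP 0 t; last by exists 0.
  have [l hl] := geometric_increments_cvg_col (fun n => yS n t t0).
  by exists l.
pose Z (t : R) := Y (Num.max 0 t).
have m0 (t : R) : 0 <= Num.max 0 t by rewrite le_max lexx.
have cm (n : nat) : continuous (fun t : R => y n (Num.max 0 t)).
  move=> t; apply: (@continuous_comp _ _ _ (fun s : R => Num.max 0 s) (y n));
    last exact: cy.
  by apply: (@continuous_max _ _ (cst 0) id); [exact: cst_continuous|exact:
    cvg_id].
(* The error bound grows with time but is uniform on times up to [Num.max 0 t + 1], so a uniform
   limit argument with three thirds of [e] applies near [t]. *)
have cZ : continuous Z.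
  move=> t; apply/cvgrPdist_lt => e e0.
  have e3 : 0 < e / 3 by rewrite divr_gt0.
  have [n hn] := half_expn_small (2 * (c * expR (K * (Num.max 0 t + 1)))) e3.
  have close s : Num.max 0 s <= Num.max 0 t + 1 ->
    `|Z s - y n (Num.max 0 s)| < e / 3.
    move=> st; apply: le_lt_trans hn; apply: le_trans (HY _ n (m0 s)) _.
    rewrite ler_wpM2r ?invr_ge0 ?exprn_ge0// ler_wpM2l// ler_wpM2l//.
    by rewrite ler_expR ler_wpM2l// ltW.
  near=> s.
  have h1 : `|Z t - y n (Num.max 0 t)| < e / 3 by apply: close; rewrite lerDl.
  have h2 : `|Z s - y n (Num.max 0 s)| < e / 3.
    apply: close; rewrite ge_max addr_ge0//=.
    apply: (@le_trans _ _ (t + 1)); last by rewrite lerD2r le_max lexx orbT.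
    by apply: ltW; near: s; apply: lt_nbhsl; rewrite ltrDl.
  have h3 : `|y n (Num.max 0 t) - y n (Num.max 0 s)| < e / 3.
    by near: s; have /cvgrPdist_lt := cm n t; exact.
  have := ler_distD (y n (Num.max 0 t)) (Z t) (Z s).
  have := ler_distD (y n (Num.max 0 s)) (y n (Num.max 0 t)) (Z s).
  by rewrite (distrC (y n (Num.max 0 s)) (Z s)); move: h1 h2 h3; lra.
have [cW W0 dW] := HPhi _ cZ.
have WZ (t : R) : 0 <= t -> Z t = Phi Z t.
  move=> t0; have Zt s : 0 <= s -> Z s = Y s by move=> s0; rewrite /Z max_r.
  (* The iterates converge to [Phi Z] as well as to [Y], so the limit is a fixed point at
     nonnegative times. *)
  have yW n : `|y n.+1 t - Phi Z t| <= c * expR (K * t) / 2 ^+ n.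
    rewrite [leRHS]mulrAC.
    apply: (@exp_growth _ _ (fun s => y n.+1 s - Phi Z s)
      (fun s => H (y n s) - H (Z s))) => //.
    - by move=> s; apply: cvgB; [exact: cy|exact: cW].
    - by rewrite y0 W0 subrr.
    - by move=> s s0; apply: is_deriveB; [exact: dy|exact: dW].
    - move=> s s0; have hs := HY s n (ltW s0).
      rewrite (le_trans (kH _ _))// (Zt s (ltW s0)) (distrC (y n s)).
      rewrite (le_trans (ler_wpM2l (ltW k0) hs))//.
      by rewrite /K; lra.
  apply/eqP; rewrite -subr_eq0 -normr_le0; apply/ler_addgt0Pr => e e0.
  have [n hn] := half_expn_small (2 * (c * expR (K * t))) e0.
  rewrite add0r -(subrKA (y n.+1 t)) (le_trans (ler_normD _ _))//.
  apply: le_trans (ltW hn); rewrite Zt//.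
  have := lerD (HY t n.+1 t0) (yW n); move/le_trans; apply.
  by rewrite exprS invfM; lra.
(* The derivative of [Phi Z] at [t] is [H (Z t)] by construction, and [Z t] equals [Phi Z t]
   there. *)
exists (Phi Z); split=> // t t0.
by rewrite -WZ ?ltW//; exact: dW.
Unshelve. all: by end_near. Qed.

(** * Dissipative differential equations *)

(** The norm on columns is the maximum norm; energy estimates use this Euclidean inner product, and
    the two are compared up to the factor [N]. *)
Definition coldot (R : realType) N (u v : 'cV[R]_N) : R := \sum_i u i 0 * v i 0.

Lemma coldot_ge0 (R : realType) N (v : 'cV[R]_N) : 0 <= coldot v v.
Proof. by apply: sumr_ge0 => i _; rewrite -expr2 sqr_ge0. Qed.

Lemma normr_sqr_le_coldot (R : realType) N (v : 'cV[R]_N) : `|v| ^+ 2 <= coldot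
  v v.
Proof.
rewrite -(sqr_sqrtr (coldot_ge0 v)) lerXn2r ?nnegrE ?sqrtr_ge0//.
apply/norm_col_le => [|i]; first exact: sqrtr_ge0.
rewrite -sqrtr_sqr ler_sqrt ?coldot_ge0// expr2 /coldot (bigD1 i)//= lerDl.
by apply: sumr_ge0 => j _; rewrite -expr2 sqr_ge0.
Qed.

Lemma coldot_le (R : realType) N (u v : 'cV[R]_N) :
  coldot u v <= N%:R * (`|u| * `|v|).
Proof.
have -> : N%:R * (`|u| * `|v|) = \sum_(i < N) `|u| * `|v|.
  by rewrite sumr_const card_ord mulr_natl.
apply: ler_sum => i _; rewrite (le_trans (ler_norm _))// normrM.
by rewrite ler_pM// norm_coord_le.
Qed.

Lemma is_derive_coldot (R : realType) N (z : R ->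
  'cV[R]_N) (t : R) (d : 'cV[R]_N) :
  is_derive t 1 z d ->
  is_derive t 1 (fun s => coldot (z s) (z s)) (2 * coldot (z t) d).
Proof.
move=> /is_derive_col dz.
rewrite (_ : (fun s => _) = \sum_i ((fun s => z s i 0) * (fun s => z s i 0))).
  rewrite /coldot mulr_sumr; apply: is_derive_sum => i.
  have dzi := dz i; apply: is_derive_eq; rewrite /GRing.scale/=; ring.
by apply/funext => s; rewrite fct_sumE.
Qed.

Lemma within_continuous_coldot (R : realType) N (A : set R) (z : R ->
  'cV[R]_N) :
  {within A, continuous z} -> {within A, continuous (fun s => coldot (z s) (z
    s))}.
Proof.
move=> cz; rewrite (_ : (fun s => _) = \sum_i ((fun s => z s i 0) * (fun s => z
  s i 0))).
  elim/big_ind: _ => [x|f g cf cg x|i _ x].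
  - exact: cvg_cst.
  - by apply: cvgD; [exact: cf|exact: cg].
  - by apply: cvgM; exact: (within_continuous_coord cz).
by apply/funext => s; rewrite fct_sumE.
Qed.

(* At the first time where [h] would reach [q] it has been nonincreasing so
  far. *)
Lemma barrier (R : realType) (h dh : R -> R) (q t : R) : 0 <= t ->
  {within `[0, t], continuous h} ->
  (forall s : R, 0 < s < t -> is_derive s 1 h (dh s) /\ (h s < q ->
    dh s <= 0)) ->
  h 0 < q -> h t < q.
Proof.
move=> t0 ch dhE h0; rewrite ltNge; apply/negP => qt.
pose A : set R := [set r | [/\ 0 <= r, r <= t & q <= h r]].
have At : A t by [].
have infA : has_inf A by split; [exists t|exists 0 => r []].
have m0 : 0 <= inf A by apply: lb_le_inf; [exists t|move=> r []].
have mt : inf A <= t by apply: ge_inf => //; case: infA.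
have below r : 0 <= r -> r < inf A -> h r < q.
  move=> r0 rm; rewrite ltNge; apply/negP => qr.
  suff : inf A <= r by rewrite leNgt rm.
  apply: ge_inf; first by case: infA.
  by split => //; rewrite (le_trans (ltW rm)).
have hm : h (inf A) < q.
  apply: le_lt_trans h0; rewrite -lerN2.
  apply: (@ge0_derive_le _ (fun s => - h s) (fun s => - dh s)) => //.
    have chm : {within `[0, inf A], continuous h}.
      by apply: continuous_subspaceW ch; apply: subset_itvl; rewrite bnd_simp.
    by move=> x; apply: cvgN; exact: chm.
  move=> s /andP[s0 sm]; have [|dhs hs] := dhE s;
    first by rewrite s0 (lt_le_trans sm).
  by split; [exact: is_deriveN|rewrite oppr_ge0 hs// below// ltW].
(* By continuity [h] stays below [q] a little to the right of [inf A], whereas points of [A] lie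
   arbitrarily close to it. *)
have /subspace_continuousP/(_ (inf A)) := ch.
rewrite /= in_itv/= m0 mt => /(_ isT)/cvgrPdist_lt.
move=> /(_ (q - h (inf A))); rewrite subr_gt0 => /(_ hm).
rewrite /within/= => /nbhs_ballP[d /= d0 hd].
have [r [r0 rt qr] rm] := inf_adherent d0 infA.
have mr : inf A <= r by apply: ge_inf => //; case: infA.
have := hd r; rewrite /ball/= in_itv/= r0 rt ler0_norm ?subr_le0// opprB.
rewrite ltrBlDl => /(_ rm isT); rewrite ltr_norml => /andP[+ _].
by rewrite ltrNl opprB ltrD2r ltNge qr.
Qed.

Lemma ode_solution_within (R : realType) (E : normedModType R) (F : E -> E)
    (T : \bar R) (z : R -> E) (t : R) :
  ode_solution F T z -> (t%:E < T)%E ->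
  {within `[0, t], continuous z} /\
  forall s : R, 0 < s -> s <= t -> is_derive s 1 z (F (z s)).
Proof.
move=> [_ cz dz] tT; split=> [|s s0 st]; last first.
  by apply: dz => //; rewrite (le_lt_trans _ tT)// lee_fin.
apply: continuous_subspaceW cz => s /=; rewrite in_itv/= => /andP[s0 st].
by split => //; rewrite (le_lt_trans _ tT)// lee_fin.
Qed.

Section Dissipative.
Context (R : realType) (N : nat).
Local Notation X := 'cV[R]_N.
Local Notation Q v := (coldot v v).

(** Where the dissipativity applies, the squared Euclidean distance has derivative at most [- 2 * g]
    times itself. Its sublevel set at [rho ^+ 2] lies inside the maximum-norm ball, so [barrier]
    keeps the trajectory in the region where this holds. *)
Lemma dissipative_decay (F : X -> X) (zs : X) (rho g : R) (T : \bar R) (z : R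
  -> X) :
  0 < rho -> 0 <= g ->
  (forall u, `|u - zs| <= rho -> coldot (u - zs) (F u) <= - g * Q (u - zs)) ->
  ode_solution F T z -> Q (z 0 - zs) < rho ^+ 2 ->
  forall t : R, 0 <= t -> (t%:E < T)%E ->
    Q (z t - zs) <= expR (- (2 * g) * t) * Q (z 0 - zs) /\ `|z t - zs| < rho.
Proof.
move=> rho0 g0 hF sol z0 t t0 tT.
have [cz dz] := ode_solution_within sol tT.
pose y s := z s - zs.
have cy : {within `[0, t], continuous y} by move=> x; apply: cvgB;
  [exact: cz|exact: cvg_cst].
have dy s : 0 < s -> s <= t -> is_derive s 1 y (F (z s)).
  move=> s0 st; rewrite -[F _]subr0.
  by apply: (@is_deriveB _ _ _ _ (cst zs)); exact: dz.
have dQ s : 0 < s -> s <= t -> is_derive s 1 (fun r => Q (y r)) (2 * coldot (y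
  s) (F (z s))).
  by move=> s0 st; apply: is_derive_coldot; exact: dy.
have cQ := within_continuous_coldot cy.
have ball_of_Q v : Q v < rho ^+ 2 -> `|v| < rho.
  move=> Qv; have := le_lt_trans (normr_sqr_le_coldot v) Qv.
  by rewrite ltr_pXn2r ?nnegrE ?(ltW rho0).
have dis s : Q (y s) < rho ^+ 2 -> coldot (y s) (F (z s)) <= - g * Q (y s).
  by move=> /ball_of_Q/ltW; exact: hF.
have inball s : 0 <= s -> s <= t -> Q (y s) < rho ^+ 2.
  move=> s0 st; apply: (@barrier _ (fun s => Q (y s)) (fun s => 2 * coldot (y
    s) (F (z s))) _ s) => //.
    by apply: continuous_subspaceW cQ; apply: subset_itvl; rewrite bnd_simp.
  move=> r /andP[r0 rs]; split; first by apply: dQ => //;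
    rewrite (le_trans (ltW rs)).
  move=> /dis/le_trans; rewrite pmulr_rle0//; apply.
  by rewrite mulNr oppr_le0 mulr_ge0// coldot_ge0.
split; last by apply: ball_of_Q; exact: inball.
(* Integrating factor: the product of [e] and the squared distance is nonincreasing. *)
pose e (s : R) := expR (2 * g * s).
have de (s : R) : is_derive s 1 e (2 * g * e s).
  by apply: is_derive_eq; rewrite /GRing.scale/= /e; ring.
have : - (e 0 * Q (y 0)) <= - (e t * Q (y t)).
  apply: (@ge0_derive_le _ (fun s => - (e s * Q (y s)))
    (fun s => - (e s * (2 * coldot (y s) (F (z s))) + Q (y s) * (2 * g * e
      s)))) => //.
    move=> x; apply: cvgN; apply: cvgM; last exact: cQ.
    suff ce : continuous e by exact: (@continuous_subspaceT _ _ _ _ ce).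
    by move=> s; apply/differentiable_continuous/derivable1_diffP;
      have [] := de s.
  move=> s /andP[s0 st]; split.
    have dQs := dQ s s0 (ltW st); have des := de s.
    apply: is_deriveN; exact: is_deriveM.
  have e0 : 0 < e s by rewrite expR_gt0.
  rewrite oppr_ge0 [X in _ + X]mulrCA -mulrA.
  have -> : e s * (2 * coldot (y s) (F (z s))) + 2 * (g * (Q (y s) * e s)) =
    (2 * e s) * (coldot (y s) (F (z s)) + g * Q (y s)) by ring.
  rewrite pmulr_rle0 ?mulr_gt0//.
  by have := dis s (inball s (ltW s0) (ltW st)); lra.
rewrite lerN2 {2}/e mulr0 expR0 mul1r mulNr expRN => h.
by rewrite ler_pdivlMl ?expR_gt0.
Qed.

(** The squared Euclidean distance between the two solutions is nonincreasing and starts at [0]. *)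
Lemma dissipative_unique (F : X -> X) (zs : X) (rho : R) (T : \bar R) (z y : R
  -> X) :
  (forall u v, `|u - zs| <= rho -> `|v - zs| <= rho ->
    coldot (u - v) (F u - F v) <= 0) ->
  ode_solution F T z -> ode_solution F T y -> z 0 = y 0 ->
  (forall t : R, 0 <= t -> (t%:E < T)%E -> `|z t - zs| <= rho /\ `|y t - zs| <=
    rho) ->
  forall t : R, 0 <= t -> (t%:E < T)%E -> y t = z t.
Proof.
move=> hF solz soly zy0 inball t t0 tT.
have [cz dz] := ode_solution_within solz tT.
have [cy dy] := ode_solution_within soly tT.
have cQ : {within `[0, t], continuous (fun s => Q (z s - y s))}.
  by apply: within_continuous_coldot => x; apply: cvgB; [exact: cz|exact: cy].
have : - Q (z 0 - y 0) <= - Q (z t - y t).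
  apply: (@ge0_derive_le _ (fun s => - Q (z s - y s))
    (fun s => - (2 * coldot (z s - y s) (F (z s) - F (y s))))) => //.
    by move=> x; apply: cvgN; exact: cQ.
  move=> s /andP[s0 st]; split.
    apply: is_deriveN; apply: (@is_derive_coldot _ _ (fun r => z r - y r)).
    by apply: is_deriveB; [apply: dz|apply: dy] => //; exact: ltW.
  rewrite oppr_ge0 pmulr_rle0//.
  have [||zb yb] := inball s; [exact: ltW| |exact: hF].
  by rewrite (le_lt_trans _ tT)// lee_fin ltW.
rewrite zy0 subrr lerN2 => h; apply/eqP; rewrite eq_sym -subr_eq0 -normr_eq0
  -sqrf_eq0.
apply/eqP/le_anti; rewrite sqr_ge0 andbT (le_trans (normr_sqr_le_coldot _))//.
by rewrite (le_trans h)// /coldot big1// => i _; rewrite mxE mul0r.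
Qed.

End Dissipative.

(** * ** Truncation and dissipative equilibria *)

Definition clamp (R : realType) (r x : R) : R := Num.max (- r) (Num.min r x).

Lemma clamp_norm_le (R : realType) (r x : R) : 0 <= r -> `|clamp r x| <= r.
Proof.
move=> r0; rewrite ler_norml le_max lexx ge_max ge_min lexx.
by rewrite (le_trans _ r0)// oppr_le0.
Qed.

Lemma clamp_id (R : realType) (r x : R) : `|x| <= r -> clamp r x = x.
Proof. by rewrite ler_norml => /andP[rx xr]; rewrite /clamp min_r// max_r. Qed.

Lemma max_dist_le (R : realType) (a x y : R) :
  `|Num.max a x - Num.max a y| <= `|x - y|.
Proof.
wlog xy : x y / x <= y => [hw|].
  by have [/hw//|/ltW/hw] := leP x y; rewrite distrC [leRHS]distrC.
have -> : `|x - y| = y - x by rewrite ler0_norm ?subr_le0// opprB.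
rewrite ler_norml; apply/andP.
have [ay|ya] := leP a y; have [ax|xa] := leP a x; split; lra.
Qed.

Lemma clamp_dist_le (R : realType) (r x y : R) : `|clamp r x - clamp r y| <=
  `|x - y|.
Proof.
rewrite /clamp (le_trans (max_dist_le _ _ _))//.
have minE z : Num.min r z = - Num.max (- r) (- z) by rewrite oppr_max !opprK.
rewrite !minE -opprD normrN (le_trans (max_dist_le _ _ _))//.
by rewrite -opprD normrN.
Qed.

(** A retraction onto the maximum-norm ball around [c], nonexpansive for that norm; composing with
    it makes a field that is Lipschitz on the ball globally Lipschitz. *)
Definition clamp_col (R : realType) N (c : 'cV[R]_N) (r : R) (u : 'cV[R]_N) :
  'cV[R]_N :=
  c + \col_i clamp r ((u - c) i 0).

Lemma clamp_col_in (R : realType) N (c : 'cV[R]_N) (r : R) u : 0 <= r ->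
  `|clamp_col c r u - c| <= r.
Proof.
by move=> r0; apply/norm_col_le => // i; rewrite addrC addKr mxE clamp_norm_le.
Qed.

Lemma clamp_col_id (R : realType) N (c : 'cV[R]_N) (r : R) u :
  `|u - c| <= r -> clamp_col c r u = u.
Proof.
move=> ur; rewrite -[RHS](subrK c) [RHS]addrC; congr (_ + _); apply/colP => i;
  rewrite mxE clamp_id//.
exact: le_trans (norm_coord_le _ i) ur.
Qed.

Lemma clamp_col_dist_le (R : realType) N (c : 'cV[R]_N) (r : R) u v : 0 <= r ->
  `|clamp_col c r u - clamp_col c r v| <= `|u - v|.
Proof.
move=> r0; apply/norm_col_le => // i.
rewrite opprD addrACA subrr add0r !mxE (le_trans (clamp_dist_le _ _ _))//.
by rewrite opprB addrA subrK; have := norm_coord_le (u - v) i; rewrite !mxE.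
Qed.

(** Existence comes from the truncated field, whose solution never leaves the ball and so solves the
    original equation. Uniqueness by dissipativity then makes every local solution a restriction of
    it, and the energy estimate gives rate [g]. *)
Lemma dissipative_equilibrium (R : realType) N (F : 'cV[R]_N -> 'cV[R]_N)
    (zs : 'cV[R]_N) (rho k g gamma : R) :
  0 < rho -> 0 < k -> 0 <= g -> gamma < g -> F zs = 0 ->
  (forall u v, `|u - zs| <= rho -> `|v - zs| <= rho ->
    `|F u - F v| <= k * `|u - v|) ->
  (forall u v, `|u - zs| <= rho -> `|v - zs| <= rho ->
     coldot (u - v) (F u - F v) <= - g * coldot (u - v) (u - v)) ->
  stable_equilibrium F zs /\ reached_with_rate_gt F zs gamma.
Proof.
move=> rho0 k0 g0 gg Fzs lipF disF.
have zsin : `|zs - zs| <= rho by rewrite subrr normr0 ltW.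
have disF0 u : `|u - zs| <= rho -> coldot (u - zs) (F u) <= - g * coldot (u -
  zs) (u - zs).
  by move=> uin; have := disF u zs uin zsin; rewrite Fzs subr0.
(* Comparison constant between the Euclidean and maximum norms; the successor keeps it positive when
   [N = 0]. *)
pose C : R := N.+1%:R; have C0 : 0 < C by rewrite ltr0n.
have C1 : N%:R <= C ^+ 2 :> R by rewrite -natrX ler_nat (leq_trans (leqnSn
  N))// -[leqLHS]expn1 leq_pexp2l.
have Q_lt (v : 'cV[R]_N) (r : R) : 0 < r -> `|v| < r / C -> coldot v v < r ^+ 2.
  move=> r0; rewrite ltr_pdivlMr// => vr.
  apply: le_lt_trans (coldot_le v v) _; rewrite -expr2.
  apply: (@le_lt_trans _ _ ((`|v| * C) ^+ 2)).
    by rewrite exprMn [leRHS]mulrC ler_wpM2r ?exprn_ge0.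
  by rewrite ltr_pXn2r ?nnegrE ?mulr_ge0 ?(ltW r0) ?(ltW C0).
pose d := rho / C; have d0 : 0 < d by rewrite divr_gt0.
have decay T z : ode_solution F T z -> `|z 0 - zs| < d ->
  forall t : R, 0 <= t -> (t%:E < T)%E ->
    coldot (z t - zs) (z t - zs) <= expR (- (2 * g) * t) * coldot (z 0 - zs) (z
      0 - zs)
    /\ `|z t - zs| < rho.
  by move=> sol z0 t t0 tT; apply: (dissipative_decay rho0 g0 disF0 sol) => //;
    exact: Q_lt.
have global z0 : `|z0 - zs| < d -> solutions_global F z0.
  move=> z0d.
  have lipG u v : `|F (clamp_col zs rho u) - F (clamp_col zs rho v)| <= k * `|u
    - v|.
    have rho0' := ltW rho0.
    rewrite (le_trans (lipF _ _ _ _)) ?clamp_col_in//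
      ler_wpM2l ?clamp_col_dist_le//.
    exact: ltW.
  have [z [cz zz0 dz]] := lipschitz_global_solution k0 lipG z0.
  have sol : ode_solution F +oo%E z.
    (* The truncated field agrees with [F] on the ball and inherits its dissipativity, so its
       solution stays where the truncation is the identity. *)
    have solG : ode_solution (F \o clamp_col zs rho) +oo%E z.
      split=> [||t t0 _]; [by rewrite ltry|exact: continuous_subspaceT|exact:
        dz].
    split=> [||t t0 _]; [by rewrite ltry|exact: continuous_subspaceT|].
    have := dz t t0; rewrite clamp_col_id//.
    suff [_ /ltW] : coldot (z t - zs) (z t - zs) <=
      expR (- (2 * g) * t) * coldot (z 0 - zs) (z 0 - zs) /\ `|z t - zs| < rho
        by [].
    apply: (dissipative_decay rho0 g0 _ solG); rewrite ?zz0 ?ltry ?(ltW t0)//.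
      by move=> u uin /=; rewrite clamp_col_id// disF0.
    exact: Q_lt.
  split; first by exists z.
  move=> T y soly y0; exists z => // t t0 tT.
  have solT : ode_solution F T z.
    have [T0 _ _] := soly; split=> // [|s s0 _];
      first exact: continuous_subspaceT.
    by case: sol => _ _; apply; rewrite ?ltry.
  apply: (@dissipative_unique _ _ F zs rho T y z) => //; first 1 last.
  - by rewrite zz0.
  - move=> s s0 sT; split; apply: ltW.
      by have [] := decay T y soly _ s s0 sT; rewrite ?y0.
    by have [] := decay T z solT _ s s0 sT; rewrite ?zz0.
  - move=> u v uin vin; apply: le_trans (disF u v uin vin) _.
    by rewrite mulNr oppr_le0 mulr_ge0// coldot_ge0.
have rate z0 : `|z0 - zs| < d -> forall z, ode_solution F +oo%E z -> z 0 = z0 ->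
    forall t : R, 0 <= t -> `|z t - zs| <= C * expR (- g * t) * `|z 0 - zs|.
  move=> z0d z sol zz0 t t0.
  have [Qt _] : coldot (z t - zs) (z t - zs) <=
      expR (- (2 * g) * t) * coldot (z 0 - zs) (z 0 - zs) /\ `|z t - zs| < rho.
    by apply: (decay +oo%E) => //; rewrite ?zz0 ?ltry.
  rewrite -(@ler_pXn2r _ 2) ?nnegrE//; last by rewrite !mulr_ge0 ?expR_ge0//
    ltW.
  apply: le_trans (normr_sqr_le_coldot _) _; apply: le_trans Qt _.
  have -> : (C * expR (- g * t) * `|z 0 - zs|) ^+ 2 =
    expR (- (2 * g) * t) * (C ^+ 2 * `|z 0 - zs| ^+ 2).
    have -> : - (2 * g) * t = - g * t + - g * t by ring.
    by rewrite expRD; ring.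
  rewrite ler_wpM2l ?expR_ge0//; apply: le_trans (coldot_le _ _) _.
  by rewrite -expr2 ler_wpM2r// sqr_ge0.
split; last by exists g, C, d; split=> // z0 z0d; split;
  [exact: global|exact: rate].
(* Stability follows from the rate estimate, since the exponential factor is at most [1]. *)
split=> // eps eps0; exists (Num.min d (eps / C));
  first by rewrite lt_min d0 divr_gt0.
move=> z0; rewrite lt_min => /andP[z0d z0e]; split; first exact: global.
move=> z sol zz0 t t0; apply: le_lt_trans (rate _ z0d z sol zz0 t t0) _.
move: z0e; rewrite ltr_pdivlMr// mulrC zz0; apply: le_lt_trans.
rewrite mulrAC ler_piMr ?mulr_ge0 ?(ltW C0)//.
by rewrite -[leRHS]expR0 ler_expR mulNr oppr_le0 mulr_ge0.
Qed.

(** * ** Equilibria of nearly diagonal fields *)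

(** Banach iteration from the centre: the first step uses at most [r / 2], and contraction towards
    [T x0] the other half, so the iterates stay in the ball. *)
Lemma half_contraction_fixpoint (R : realType) N (T : 'cV[R]_N -> 'cV[R]_N)
    (x0 : 'cV[R]_N) (r : R) : 0 <= r ->
  (forall u v, `|u - x0| <= r -> `|v - x0| <= r ->
    `|T u - T v| <= `|u - v| / 2) ->
  `|T x0 - x0| <= r / 2 ->
  exists2 u, `|u - x0| <= r & T u = u.
Proof.
move=> r0 ctrT Tx0; pose u n := iter n T x0.
have x0in : `|x0 - x0| <= r by rewrite subrr normr0.
have uin n : `|u n - x0| <= r.
  elim: n => [//|n IH]; rewrite -(subrKA (T x0)) (le_trans (ler_normD _ _))//.
  by have := ctrT _ _ IH x0in; rewrite /u iterS; move: IH; rewrite /u; lra.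
have du n : `|u n.+1 - u n| <= (r / 2) / 2 ^+ n.
  elim: n => [|n IH]; first by rewrite expr0 divr1.
  by have := ctrT _ _ (uin n.+1) (uin n); rewrite /u !iterS exprS invfM;
    move: IH; rewrite /u !iterS; lra.
have [l hl] := geometric_increments_cvg_col du.
have lin : `|l - x0| <= r by have := hl 0%N; rewrite expr0 /u /=; lra.
exists l => //; apply/eqP; rewrite -subr_eq0 -normr_le0;
  apply/ler_addgt0Pr => e e0.
have [n hn] := half_expn_small (r * 2) e0.
rewrite add0r -(subrKA (u n.+1)) (le_trans (ler_normD _ _))//.
have h1 := ctrT _ _ lin (uin n); have h2 := hl n; have h3 := hl n.+1.
move: h1 h2 h3; rewrite (distrC l (u n.+1)) exprS invfM; move: hn.
rewrite [T (u n)](_ : _ = u n.+1)//; lra.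
Qed.

(** The simplified Newton map [u - D^-1 (H u)], with [D] the diagonal matrix of [lam], is a half
    contraction because every [lam] has modulus at least [2]. Around its fixed point the
    perturbation costs at most [1] of the dissipation rate [gamma + 2], which leaves [gamma + 1]. *)
Lemma near_diagonal_equilibrium (R : realType) N (H : 'cV[R]_N -> 'cV[R]_N)
    (x0 : 'cV[R]_N) (lam : 'rV[R]_N) (gamma r : R) : 0 < gamma -> 0 < r ->
  (forall i, lam 0 i <= - (gamma + 2)) ->
  (forall u v, `|u - x0| <= r -> `|v - x0| <= r ->
     `|H u - H v - diag_mx lam *m (u - v)| <= N.+1%:R^-1 * `|u - v|) ->
  `|H x0| <= r / 2 ->
  exists2 zs, `|zs - x0| <= r / 2 &
    stable_equilibrium H zs /\ reached_with_rate_gt H zs gamma.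
Proof.
move=> gamma0 r0 lam_le nearH Hx0.
have lam0 i : lam 0 i != 0 by rewrite lt_eqF// (le_lt_trans (lam_le i))//
  oppr_lt0 addr_gt0.
have r2 : 0 < r / 2 by rewrite divr_gt0.
have r2r : r / 2 <= r by rewrite ler_pdivrMr// ler_peMr ?ler1n// ltW.
have eps1 : N.+1%:R^-1 <= 1 :> R by rewrite invf_le1 ?ltr0n// ler1n.
pose Di (w : 'cV[R]_N) : 'cV[R]_N := \col_i (w i 0 / lam 0 i).
have Di_le w : `|Di w| <= `|w| / 2.
  apply/norm_col_le => [|i]; first by rewrite divr_ge0.
  rewrite mxE normrM ler_pM ?norm_coord_le// normfV lef_pV2 ?posrE ?normr_gt0//.
  by rewrite ler0_norm; have := lam_le i; lra.
pose T u := u - Di (H u).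
have [zs zs_in Tzs] : exists2 u, `|u - x0| <= r / 2 & T u = u.
  apply: half_contraction_fixpoint; first exact: ltW.
    move=> u v /le_trans/(_ r2r) uin /le_trans/(_ r2r) vin.
    have -> : T u - T v = - Di (H u - H v - diag_mx lam *m (u - v)).
      apply/colP => i; rewrite mul_diag_mx !mxE; field; exact: lam0.
    rewrite normrN (le_trans (Di_le _))// ler_wpM2r//
      (le_trans (nearH _ _ uin vin))//.
    by rewrite ler_piMl.
  rewrite /T addrAC subrr sub0r normrN (le_trans (Di_le _))// ler_wpM2r//.
have Hzs : H zs = 0.
  apply/colP => i; move/colP/(_ i): Tzs; rewrite !mxE => h.
  have {h} : H zs i 0 / lam 0 i = 0 by move: h; lra.
  by move/eqP; rewrite mulf_eq0 invr_eq0 (negbTE (lam0 i)) orbF => /eqP.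
exists zs => //.
(* The equilibrium is sought within [r / 2] of [x0] so that a ball of radius [r / 2] around it still
   lies where [nearH] holds. *)
have in_r u : `|u - zs| <= r / 2 -> `|u - x0| <= r.
  by move=> uz; have := ler_distD zs u x0; move: uz zs_in; lra.
pose L := \sum_i `|lam 0 i|.
have L0 : 0 <= L by apply: sumr_ge0.
have D_le (w : 'cV[R]_N) : `|diag_mx lam *m w| <= L * `|w|.
  apply/norm_col_le => [|i]; first by rewrite mulr_ge0.
  rewrite mul_diag_mx mxE normrM ler_pM ?norm_coord_le//.
  by rewrite /L (bigD1 i)//= lerDl sumr_ge0.
apply: (@dissipative_equilibrium _ _ H zs (r / 2) (L + 1) (gamma + 1)) => //.
- by rewrite ltr_wpDl.
- by rewrite addr_ge0// ltW.
- by rewrite ltrDl.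
- move=> u v /in_r uin /in_r vin.
  rewrite -[H u - H v](subrK (diag_mx lam *m (u - v))) addrC.
  rewrite (le_trans (ler_normD _ _))// mulrDl mul1r lerD ?D_le//.
  by rewrite (le_trans (nearH _ _ uin vin))// ler_piMl.
- move=> u v /in_r uin /in_r vin.
  set w := u - v; have := nearH _ _ uin vin; rewrite -/w;
    set e := _ - _ *m _ => e_le.
  have -> : H u - H v = diag_mx lam *m w + e by rewrite /e [RHS]addrC subrK.
  clearbody e w; rewrite (_ : coldot w (_ + e) = coldot w (diag_mx lam *m w) +
    coldot w e); last first.
    by rewrite /coldot -big_split/=; apply: eq_bigr => i _; rewrite mxE mulrDr.
  have h1 : coldot w (diag_mx lam *m w) <= - (gamma + 2) * coldot w w.
    rewrite /coldot mulr_sumr; apply: ler_sum => i _.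
    by rewrite mul_diag_mx mxE [leLHS]mulrCA ler_wpM2r// -expr2 sqr_ge0.
  (* The factor [N] lost in [coldot_le] is absorbed by the constant [N.+1%:R^-1] of the
     perturbation. *)
  have h2 : coldot w e <= coldot w w.
    apply: le_trans (normr_sqr_le_coldot w); apply: le_trans (coldot_le _ _) _.
    rewrite expr2 mulrCA ler_wpM2l//.
    apply: (@le_trans _ _ (N%:R * (N.+1%:R^-1 * `|w|)));
      first by rewrite ler_wpM2l.
    by rewrite mulrA -[leRHS]mul1r ler_wpM2r// ler_pdivrMr ?ltr0n//
      mul1r ler_nat leqnSn.
  by have := coldot_ge0 w; move: h1 h2; lra.
Qed.

(** * ** Linear changes of coordinates *)

Lemma is_derive_comp_diff (R : realType) (E X : normedModType R) (f : E -> X)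
    (z : R -> E) (t : R) (d : E) :
  differentiable f (z t) -> is_derive t 1 z d ->
    is_derive t 1 (f \o z) ('d f (z t) d).
Proof.
move=> ft dz; have [zt dE] := dz.
have zt' : differentiable z t by apply/derivable1_diffP.
have fz : differentiable (f \o z) t by exact: differentiable_comp.
split; first exact/derivable1_diffP.
by rewrite deriveE// diff_comp//= -(deriveE _ zt') dE.
Qed.

Lemma is_derive_linear (R : realType) (E X : normedModType R) (S : {linear E ->
  X})
    (z : R -> E) (t : R) (d : E) :
  continuous S -> is_derive t 1 z d -> is_derive t 1 (S \o z) (S d).
Proof.
move=> cS dz; have St : differentiable S (z t) by exact: linear_differentiable.
by have := is_derive_comp_diff St dz; rewrite diff_lin.
Qed.

Lemma conj_ode_solution (R : realType) (E X : normedModType R) (S : {linear E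
  -> X}) (F : E -> E) (H : X -> X)
    (T : \bar R) (z : R -> E) :
  continuous S -> (forall v, S (F v) = H (S v)) ->
  ode_solution F T z -> ode_solution H T (S \o z).
Proof.
move=> cS SF [T0 cz dz]; split=> // [x|t t0 tT].
  by apply: (@continuous_comp (subspace _) _ _ z S); [exact: cz|exact: cS].
by rewrite /= -SF; apply: is_derive_linear => //; exact: dz.
Qed.

Lemma bounded_linear_continuous (R : realType) (V W : normedModType R) (L :
  {linear V -> W}) (k : R) :
  0 < k -> (forall v, `|L v| <= k * `|v|) -> continuous L.
Proof.
move=> k0 kL v; apply/(@cvgrPdist_lt _ _ _ (nbhs v) _) => e e0; near=> w.
rewrite -linearB (le_lt_trans (kL _))// -ltr_pdivlMl//.
near: w; have /cvgrPdist_lt := @cvg_id _ (nbhs v); apply.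
by rewrite mulr_gt0// invr_gt0.
Unshelve. all: by end_near. Qed.

Section Conjugacy.
Context (R : realType) (E X : normedModType R).

Context (S : {linear E -> X}) (S' : {linear X -> E}) (c c' : R).
Hypotheses (c0 : 0 < c) (c'0 : 0 < c').
Hypotheses (S_le : forall v, `|S v| <= c * `|v|) (S'_le : forall w, `|S' w| <=
  c' * `|w|).
Hypotheses (SK : cancel S S') (S'K : cancel S' S).

Variables (F : E -> E) (H : X -> X).
Hypothesis HE : forall w, H w = S (F (S' w)).

Let cS : continuous S. Proof. exact: bounded_linear_continuous S_le. Qed.
Let cS' : continuous S'. Proof. exact: bounded_linear_continuous S'_le. Qed.

Let SF v : S (F v) = H (S v). Proof. by rewrite HE SK. Qed.
Let S'H w : S' (H w) = F (S' w). Proof. by rewrite HE SK. Qed.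

Lemma conj_solutions_global z0 : solutions_global H (S z0) ->
  solutions_global F z0.
Proof.
move=> [[w solw w0] hw]; split.
  exists (S' \o w); first exact: (conj_ode_solution cS' S'H solw).
  by rewrite /= w0 SK.
move=> T z solz zz0; have [||y soly yz] := hw T (S \o z).
- exact: (conj_ode_solution cS SF solz).
- by rewrite /= zz0.
exists (S' \o y); first exact: (conj_ode_solution cS' S'H soly).
by move=> t t0 tT; rewrite /= yz//= SK.
Qed.

Lemma conj_stable_equilibrium (zs : X) :
  stable_equilibrium H zs -> stable_equilibrium F (S' zs).
Proof.
move=> [Hzs st]; split; first by rewrite /equilibrium -S'H Hzs linear0.
move=> eps eps0; have [|d d0 hd] := st (eps / c'); first by rewrite divr_gt0.
exists (d / c); first by rewrite divr_gt0.
move=> z0 z0d; have [|glob hz] := hd (S z0).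
  rewrite -[zs]S'K -linearB (le_lt_trans (S_le _))//.
  by rewrite mulrC -ltr_pdivlMr.
split; first exact: conj_solutions_global.
move=> z sol zz0 t t0.
have := hz (S \o z) (conj_ode_solution cS SF sol);
  rewrite /= zz0 => /(_ erefl t t0).
rewrite ltr_pdivlMr// mulrC; apply: le_lt_trans.
by rewrite -{1}[z t]SK -linearB S'_le.
Qed.

(** Distances change only by the factors [c] and [c'], which enter the prefactor and the radius but
    leave the exponent intact. *)
Lemma conj_reached_with_rate_gt (zs : X) (gamma : R) :
  reached_with_rate_gt H zs gamma -> reached_with_rate_gt F (S' zs) gamma.
Proof.
move=> [g [C [d [gg C0 d0 hd]]]]; exists g, (c' * C * c), (d / c).
split=> //; [by rewrite !mulr_gt0|by rewrite divr_gt0|].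
move=> z0 z0d; have [|glob hz] := hd (S z0).
  rewrite -[zs]S'K -linearB (le_lt_trans (S_le _))//.
  by rewrite mulrC -ltr_pdivlMr.
split; first exact: conj_solutions_global.
move=> z sol zz0 t t0.
have := hz (S \o z) (conj_ode_solution cS SF sol);
  rewrite /= zz0 => /(_ erefl t t0) h.
rewrite -{1}[z t]SK -linearB (le_trans (S'_le _))//
  -!mulrA ler_wpM2l ?(ltW c'0)//.
rewrite (le_trans h)// -!mulrA ler_wpM2l ?(ltW C0)//
  mulrCA ler_wpM2l ?expR_ge0//.
by rewrite -[zs in leLHS]S'K -linearB S_le.
Qed.

End Conjugacy.

(** * The closed loop *)

(** Mean value inequality along the segment from [y] to [x] for [f] minus its linearization at [p]:
    the derivative is the difference of two differentials, small near [p]. *)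
Lemma strictly_differentiable (R : realType) (V : normedModType R) N
    (f : V -> 'cV[R]_N) (p : V) (eps : R) :
  continuously_differentiable f -> 0 < eps ->
  exists2 r, 0 < r & forall x y, `|x - p| < r -> `|y - p| < r ->
    `|f x - f y - 'd f p (x - y)| <= eps * `|x - y|.
Proof.
move=> [df cdf] eps0; have /nbhs_normP[r /= r0 hr] := cdf p eps eps0.
exists r => // x y xr yr; set v := x - y.
pose q (t : R) := y + t *: v.
have qr (t : R) : 0 < t < 1 -> `|q t - p| < r.
  move=> /andP[t0 t1].
  have -> : q t - p = (1 - t) *: (y - p) + t *: (x - p).
    rewrite scalerBl scale1r -[RHS]addrA [in RHS](addrC (- _)) -scalerBr opprB.
    by rewrite [x - p + _]addrA subrK addrAC.
  rewrite (le_lt_trans (ler_normD _ _))// !normrZ !gtr0_norm ?subr_gt0//.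
  apply: (@lt_le_trans _ _ ((1 - t) * r + t * r));
    last by rewrite -mulrDl subrK mul1r.
  by rewrite ltrD// ltr_pM2l// subr_gt0.
have dq (t : R) : is_derive t 1 q v.
  rewrite -[v in is_derive _ _ _ v]add0r; apply: (@is_deriveD _ _ _ (cst y)).
  split; first exact/derivable1_diffP.
  by rewrite deriveE// diff_val/= scale1r.
have dg (t : R) : is_derive t 1 (fun s => f (q s) - s *: 'd f p v) ('d f (q t)
  v - 'd f p v).
  apply: is_deriveB; first exact: is_derive_comp_diff.
  split; first exact/derivable1_diffP.
  by rewrite deriveE// diff_val/= scale1r.
have cont (X : normedModType R) (g g' : R -> X) :
    (forall t : R, is_derive t 1 g (g' t)) -> {within `[0, 1], continuous g}.
  move=> gE; apply: continuous_subspaceT => t.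
  by apply/differentiable_continuous/derivable1_diffP; have [] := gE t.
have dh (t : R) : is_derive t 1 (fun s : R => s * (eps * `|v|)) (eps * `|v|).
  by apply: is_derive_eq; rewrite /GRing.scale/=; ring.
have := @norm_increment_le _ _ _ _ _ _ 0 1 ler01 (cont _ _ _ dg) (cont _ _ _ dh)
  (fun t _ => dg t) (fun t _ => dh t).
have -> : q 0 = y by rewrite /q scale0r addr0.
have -> : q 1 = x by rewrite /q scale1r /v addrC subrK.
rewrite scale0r scale1r mul0r mul1r !subr0 addrAC.
by apply => t t01; apply: hr; rewrite /= distrC; exact: qr.
Qed.

Section TotalDifferential.
Context (R : realType) (n : nat) (f : 'cV[R]_n -> R -> R -> 'cV[R]_n).
Let fp (p : 'cV[R]_n * R * R) := f p.1.1 p.1.2 p.2.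

(** Each partial derivative is the differential applied to a basis direction; linearity does the
    rest. *)
Lemma total_differential (x : 'cV[R]_n) (mu u : R) (z : 'cV[R]_n * R * R) :
  differentiable fp (x, mu, u) ->
  'd fp (x, mu, u) z = partial1 f x mu u *m z.1.1 + z.1.2 *: partial2 f x mu u
    + z.2 *: partial3 f x mu u.
Proof.
move=> df; case: z => -[v m] w /=.
have e1 j : 'D_(delta_mx j 0) (fun y => f y mu u) x = 'd fp (x, mu, u)
  (delta_mx j 0, 0, 0).
  rewrite -deriveE// /derive.
  by under [in RHS]eq_fun => h do rewrite /= /fp /= !scaler0 !add0r.
have e2 : partial2 f x mu u = 'd fp (x, mu, u) (0, 1, 0).
  rewrite -deriveE// /partial2 derive1E /derive.
  by under [in RHS]eq_fun => h do rewrite /= /fp /= !scaler0 !add0r.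
have e3 : partial3 f x mu u = 'd fp (x, mu, u) (0, 0, 1).
  rewrite -deriveE// /partial3 derive1E /derive.
  by under [in RHS]eq_fun => h do rewrite /= /fp /= !scaler0 !add0r.
have -> : partial1 f x mu u *m v = 'd fp (x, mu, u) (v, 0, 0).
  have -> : (v, 0, 0) = \sum_j v j 0 *: ((delta_mx j 0, 0, 0) : 'cV[R]_n * R *
    R).
    pose inc (y : 'cV[R]_n) : 'cV[R]_n * R * R := (y, 0, 0).
    have incD : {morph inc : y w / y + w} by move=> y w'; rewrite /inc;
      congr (_, _, _); rewrite addr0.
    rewrite -/(inc v) {1}(matrix_sum_delta v) (big_morph inc incD (erefl : inc
      0 = 0)).
    apply: eq_bigr => i _; rewrite big_ord1 /inc.
    by congr (_, _, _); rewrite /= scaler0.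
  rewrite linear_sum; apply/colP => i; rewrite summxE mxE.
  by apply: eq_bigr => j _; rewrite linearZ !mxE e1 mulrC.
rewrite e2 e3 -!linearZ -!linearD; congr ('d fp _ _).
congr (_, _, _); rewrite /= ?scaler0 ?addr0 ?add0r//; exact/esym/mulr1.
Qed.

End TotalDifferential.

(** * ** Augmented state and linearization *)

Section Stack.
Context (R : realType) (n : nat).

(* The scalar [z.2] comes first, so that the index type is a successor. *)
Definition stack (z : 'cV[R]_n * R) : 'cV[R]_(1 + n) := col_mx z.2%:M z.1.

Definition unstack (v : 'cV[R]_(1 + n)) : 'cV[R]_n * R :=
  (dsubmx v, usubmx v 0 0).

Lemma stackK : cancel stack unstack.
Proof. by move=> [x m]; rewrite /unstack /stack col_mxKd col_mxKu mxE mulr1n.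
  Qed.

Lemma unstackK : cancel unstack stack.
Proof. by move=> v; rewrite /stack /= -mx11_scalar vsubmxK. Qed.

Lemma stack_is_linear : linear stack.
Proof.
move=> k z w; rewrite /stack scale_col_mx add_col_mx /=; congr col_mx.
by rewrite raddfD/= scale_scalar_mx.
Qed.

HB.instance Definition _ := GRing.isLinear.Build R _ _ _ stack stack_is_linear.

Lemma unstack_is_linear : linear unstack.
Proof. by move=> k v w; rewrite /unstack !linearP/= !mxE. Qed.

HB.instance Definition _ := GRing.isLinear.Build R _ _ _ unstack
  unstack_is_linear.

Lemma stack_norm_le z : `|stack z| <= `|z|.
Proof.
apply/norm_col_le => // i; rewrite /stack; case: (split_ordP i) => j ->.
  by rewrite col_mxEu ord1 mxE mulr1n le_max lexx orbT.
by rewrite col_mxEd (le_trans (norm_coord_le _ _))// le_max lexx.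
Qed.

Lemma unstack_norm_le v : `|unstack v| <= `|v|.
Proof.
rewrite ge_max; apply/andP; split.
  by apply/norm_col_le => // i; rewrite mxE norm_coord_le.
by rewrite /= mxE norm_coord_le.
Qed.

End Stack.

Lemma mulmx_norm_le (R : realType) m N (A : 'M[R]_(m, N)) :
  exists2 c : R, 0 < c & forall v : 'cV[R]_N, `|A *m v| <= c * `|v|.
Proof.
pose c : R := \sum_i \sum_j `|A i j|.
have c0 : 0 <= c by apply: sumr_ge0 => i _; apply: sumr_ge0.
exists (c + 1) => [|v]; first by rewrite ltr_wpDl.
rewrite (@le_trans _ _ (c * `|v|)) ?ler_wpM2r ?lerDl//.
apply/norm_col_le => [|i]; first by rewrite mulr_ge0.
rewrite mxE (le_trans (ler_norm_sum _ _ _))//.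
apply: (@le_trans _ _ (\sum_j `|A i j| * `|v|)).
  by apply: ler_sum => j _; rewrite normrM ler_wpM2l// norm_coord_le.
rewrite -mulr_suml ler_wpM2r// /c (bigD1 i)//= lerDl.
by apply: sumr_ge0 => k _; apply: sumr_ge0.
Qed.

(** The top row of the augmented matrix is zero, so every column after the first has zero top entry,
    and its lower part is a Krylov column of [c + a *: (A *m b)] with exponent lowered by one. *)
Lemma krylov_augmented (R : realType) n (A : 'M[R]_n) (b c : 'cV[R]_n) (a : R) :
  krylov_mx (block_mx 0 0 c A : 'M[R]_(1 + n)) (col_mx 1%:M (a *: b)) =
  block_mx 1%:M 0 (a *: b) (krylov_mx A c + a *: (A *m krylov_mx A b)).
Proof.
pose M : 'M[R]_(1 + n) := block_mx 0 0 c A.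
have MS k : M ^+ k.+1 *m col_mx 1%:M (a *: b) =
    col_mx 0 (A ^+ k *m (c + a *: (A *m b))).
  elim: k => [|k IH].
    by rewrite expr1 mul_block_col !mul0mx addr0 expr0 mulmx1 mul1mx scalemxAr.
  by rewrite exprS -mulmxA IH mul_block_col !mul0mx addr0 mulmx0 add0r exprS
    mulmxA.
apply/matrixP => i j; rewrite mxE -/M.
case: (split_ordP j) => k ->.
  rewrite ord1 expr0 mul1mx; case: (split_ordP i) => l ->.
    by rewrite block_mxEul col_mxEu ord1.
  by rewrite block_mxEdl col_mxEd.
rewrite MS; case: (split_ordP i) => l ->.
  by rewrite block_mxEur col_mxEu !mxE.
have comm : A ^+ k *m A = A *m A ^+ k by rewrite -[LHS]/(A ^+ k * A) -exprSr
  exprS.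
rewrite block_mxEdr col_mxEd mulmxDr -scalemxAr mulmxA comm -mulmxA.
by rewrite !mxE; congr (_ + _ * _); apply: eq_bigr => m _; rewrite [in RHS]mxE.
Qed.

Section ClosedLoop.
Context (R : realType) (nx : nat) (f : 'cV[R]_nx -> R -> R -> 'cV[R]_nx).
Context (K : 'rV[R]_(1 + nx)) (a : R).
Local Notation fb := (feedback (rsubmx K) (lsubmx K 0 0)).
Local Notation F := (controlled_system f (rsubmx K) (lsubmx K 0 0) a).
Let fp (p : 'cV[R]_nx * R * R) := f p.1.1 p.1.2 p.2.
Let P (ref z : 'cV[R]_nx * R) : 'cV[R]_nx * R * R := (z, a * fb ref z).

Lemma feedbackE ref z : fb ref z = (K *m stack (ref - z)) 0 0.
Proof.
rewrite -[K in K *m _]hsubmxK /stack mul_row_col mul_mx_scalar.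
by rewrite /feedback addrC !mxE [in RHS]mulrC.
Qed.

Lemma feedbackB ref z w : fb ref z - fb ref w = - (K *m stack (z - w)) 0 0.
Proof.
rewrite !feedbackE; have -> : ref - z = ref - w - (z - w).
  by rewrite opprB addrA subrK.
by rewrite [stack (_ - (z - w))]linearB mulmxBr !mxE addrAC subrr sub0r.
Qed.

Lemma feedback_norm_le kap ref z : (forall v : 'cV[R]_(1 + nx), `|K *m v| <=
  kap * `|v|) ->
  0 < kap -> `|fb ref z| <= kap * `|ref - z|.
Proof.
move=> hkap kap0; rewrite feedbackE (le_trans (norm_coord_le _ _))//.
by rewrite (le_trans (hkap _))// ler_wpM2l ?stack_norm_le// ltW.
Qed.

(** The feedback is affine, so the linear parts cancel: the [mu] component leaves no remainder and
    the [x] component only that of [f]. The closed-loop matrix is the same for all [ref], which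
    makes later estimates uniform in the reference. *)
Lemma stack_closed_loopB (xeq : 'cV[R]_nx) (mueq : R) ref z w :
  differentiable fp (xeq, mueq, 0) ->
  stack (F ref z - F ref w) -
    ((block_mx 0 0 (partial2 f xeq mueq 0) (partial1 f xeq mueq 0) : 'M[R]_(1 +
      nx))
      - col_mx 1%:M (a *: partial3 f xeq mueq 0) *m K) *m stack (z - w) =
  col_mx 0 (fp (P ref z) - fp (P ref w) - 'd fp (xeq, mueq, 0) (P ref z - P ref
    w)).
Proof.
move=> df; rewrite mulmxBl -mulmxA; set v := K *m stack (z - w).
have fbB : fb ref z - fb ref w = - v 0 0 by rewrite feedbackB.
rewrite (mx11_scalar v) mul_col_mx !mul_mx_scalar /stack !mul_row_col !mul0mx
  add0r !mul_mx_scalar scale_col_mx.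
rewrite opp_col_mx add_col_mx opp_col_mx add_col_mx /= fbB; clearbody v;
  congr col_mx.
  by apply/matrixP => i j; rewrite !mxE !ord1 /=; ring.
rewrite (total_differential _ df) /= -mulrBr fbB mulrN scaleNr (mulrC a (v 0
  0)) -scalerA.
by rewrite [partial1 _ _ _ _ *m _ + _]addrC.
Qed.

End ClosedLoop.

Theorem corollary3p4 (R : realType) (nx : nat)
  (f : 'cV[R]_nx -> R -> R -> 'cV[R]_nx)
  (f_C1 : continuously_differentiable
            (fun p : 'cV[R]_nx * R * R => f p.1.1 p.1.2 p.2))
  (xeq : 'cV[R]_nx) (mueq : R) (f_eq : f xeq mueq 0 = 0)
  (gamma : R) (gamma_gt0 : 0 < gamma) :
  let fx := partial1 f xeq mueq 0 in
  let fmu := partial2 f xeq mueq 0 in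
  let fu := partial3 f xeq mueq 0 in
  let Ru := krylov_mx fx fu in
  let Rmu := krylov_mx fx fmu in
  regular_pair Rmu (fx *m Ru) ->
  exists (Kx : 'rV[R]_nx) (Kmu a : R),
    forall V : set ('cV[R]_nx * R), nbhs (xeq, mueq) V ->
    exists2 U : set ('cV[R]_nx * R), nbhs (xeq, mueq) U &
      forall ref : 'cV[R]_nx * R, U ref ->
      exists2 cn : 'cV[R]_nx * R, V cn &
        stable_equilibrium (controlled_system f Kx Kmu a ref) cn /\
        reached_with_rate_gt (controlled_system f Kx Kmu a ref) cn gamma.
Proof.
(* The gain [a] is a parameter at which the matrix pencil is nonsingular. *)
move=> fx fmu fu Ru Rmu /existsNP[a /eqP da].
pose A : 'M[R]_(1 + nx) := block_mx 0 0 fmu fx.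
pose B : 'cV[R]_(1 + nx) := col_mx 1%:M (a *: fu).
have uAB : krylov_mx A B \in unitmx.
  by rewrite krylov_augmented unitmxE det_lblock det1 mul1r unitfE.
have [lam [lam_inj lam_le uA]] : exists lam : 'I_(1 + nx) -> R,
    [/\ injective lam, forall i, lam i <= - (gamma + 2) &
      forall i, A - (lam i)%:M \in unitmx].
  have [c hc] := shift_unitmx_ltr A.
  pose m := Num.min c (- (gamma + 2)).
  have mc : m <= c by rewrite ge_min lexx.
  have mg : m <= - (gamma + 2) by rewrite ge_min lexx orbT.
  (* Consecutive unit steps make the poles distinct; starting at [m - 1] puts them strictly below
     [c]. *)
  exists (fun i => m - i.+1%:R); split=> [i j /addrI/oppr_inj/eqP|i|i].
  - by rewrite eqr_nat eqSS => /eqP/val_inj.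
  - by rewrite lerBlDr (le_trans mg)// lerDl.
  - by apply: hc; rewrite ltrBlDr (le_lt_trans mc)// ltrDl ltr0n.
have [K [W [uW KW]]] : exists (K : 'rV[R]_(1 + nx)) (W : 'M[R]_(1 + nx)),
    W \in unitmx /\ (A - B *m K) *m W = W *m diag_mx (\row_i lam i).
  exact: pole_placement uAB lam_inj uA.
exists (rsubmx K), (lsubmx K 0 0), a => V /nbhs_normP[rV /= rV0 hV].
pose zeq : 'cV[R]_nx * R := (xeq, mueq).
pose fp (p : 'cV[R]_nx * R * R) := f p.1.1 p.1.2 p.2.
pose fb := feedback (rsubmx K) (lsubmx K 0 0).
pose F := controlled_system f (rsubmx K) (lsubmx K 0 0) a.
pose P (ref z : 'cV[R]_nx * R) : 'cV[R]_nx * R * R := (z, a * fb ref z).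
pose p0 : 'cV[R]_nx * R * R := (zeq, 0).
have dfp : differentiable fp p0 by case: f_C1.
have [kap kap0 hkap] := mulmx_norm_le K.
have fb_le ref z : `|fb ref z| <= kap * `|ref - z| by exact: feedback_norm_le.
have [c1 c10 hc1] := mulmx_norm_le (invmx W).
have [c2 c20 hc2] := mulmx_norm_le W.
(* Modal coordinates: the columns of [W] are eigenvectors of [A - B *m K]. *)
pose S : {linear ('cV[R]_nx * R)%type -> 'cV[R]_(1 + nx)} :=
  mulmx (invmx W) \o @stack R nx.
pose S' : {linear 'cV[R]_(1 + nx) -> ('cV[R]_nx * R)%type} :=
  @unstack R nx \o mulmx W.
have S_le v : `|S v| <= c1 * `|v|.
  by rewrite (le_trans (hc1 _))// ler_wpM2l ?stack_norm_le// ltW.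
have S'_le w : `|S' w| <= c2 * `|w|.
  exact: le_trans (unstack_norm_le _) (hc2 w).
have SK : cancel S S' by move=> v; rewrite /= mulKVmx// stackK.
have S'K : cancel S' S by move=> w; rewrite /= unstackK mulKmx.
(* A common Lipschitz constant for all the maps [P ref]. *)
pose q := 1 + `|a| * kap.
have q1 : 1 <= q by rewrite lerDl mulr_ge0// ltW.
have q0 : 0 < q by apply: lt_le_trans q1.
(* Chosen so that [c1 * eps * q * c2] is exactly the perturbation constant of
   [near_diagonal_equilibrium] in dimension [1 + nx]. *)
pose eps : R := ((1 + nx).+1%:R * (c1 * q * c2))^-1.
have eps0 : 0 < eps by rewrite invr_gt0 !mulr_gt0 ?ltr0n.
have [r1 r10 hr1] := strictly_differentiable p0 f_C1 eps0.
(* State and reference are then at most [2 * s] apart, so [P ref z] is within [2 * q * s < r1] of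
   [p0]; the bound by [rV] serves to reach [V]. *)
pose s := Num.min (r1 / (4 * q)) rV.
have s0 : 0 < s by rewrite lt_min rV0 andbT divr_gt0// mulr_gt0.
have P_in ref z : `|z - zeq| <= s -> `|ref - zeq| <= s -> `|P ref z - p0| < r1.
  move=> zs refs.
  have sr1 : 2 * (q * s) < r1.
    have : s <= r1 / (4 * q) by rewrite ge_min lexx.
    rewrite ler_pdivlMr ?mulr_gt0//; lra.
  have sq : s <= q * s by rewrite ler_peMl// ltW.
  rewrite gt_max /= subr0 (le_lt_trans zs) ?(le_lt_trans sq)//=;
    last by move: sq s0 sr1; lra.
  apply: le_lt_trans sr1; rewrite normrM.
  apply: (@le_trans _ _ (`|a| * (kap * (2 * s)))).
    rewrite ler_wpM2l// (le_trans (fb_le _ _))// ler_wpM2l ?(ltW kap0)//.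
    by have := ler_distD zeq ref z; rewrite (distrC zeq z); lra.
  by rewrite /q; move: (ltW s0); lra.
have PB_le ref z w : `|P ref z - P ref w| <= q * `|z - w|.
  rewrite ge_max /= ler_peMl//= -mulrBr normrM feedbackB normrN.
  rewrite (@le_trans _ _ (`|a| * (kap * `|z - w|)))//; last first.
    by rewrite mulrA ler_wpM2r// lerDr.
  rewrite ler_wpM2l// (le_trans (norm_coord_le _ _))// (le_trans (hkap _))//.
  by rewrite ler_wpM2l ?stack_norm_le// ltW.
pose r := s / c2; have r0 : 0 < r by rewrite divr_gt0.
have S'_in w : `|w - S zeq| <= r -> `|S' w - zeq| <= s.
  move=> wr; rewrite -[zeq]SK -linearB (le_trans (S'_le _))//.
  by rewrite mulrC -ler_pdivlMr.
pose H ref w := S (F ref (S' w)).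
have H_near ref u v : `|ref - zeq| <= s -> `|u - S zeq| <= r ->
  `|v - S zeq| <= r ->
    `|H ref u - H ref v - diag_mx (\row_i lam i) *m (u - v)| <= (1 +
      nx).+1%:R^-1 * `|u - v|.
  move=> refs /S'_in us /S'_in vs.
  have stackB : stack (S' u - S' v) = W *m (u - v) by rewrite -linearB /=
    unstackK.
  have -> : H ref u - H ref v - diag_mx (\row_i lam i) *m (u - v) = invmx W *m
     (stack (F ref (S' u) - F ref (S' v)) - (A - B *m K) *m stack (S' u - S'
       v)).
    rewrite stackB (mulmxA (A - B *m K)) KW -mulmxA [RHS]mulmxBr mulKmx//;
      congr (_ - _).
    by rewrite /H -linearB.
  rewrite (stack_closed_loopB _ _ _ _ _ dfp).
  rewrite (le_trans (hc1 _))//.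
  have := hr1 (P ref (S' u)) (P ref (S' v)) (P_in _ _ us refs) (P_in _ _ vs
    refs).
  set e := _ - 'd _ _ _ => e_le.
  have col_le : `|col_mx 0 e : 'cV[R]_(1 + nx)| <= `|e|.
    apply/norm_col_le => // i; case: (split_ordP i) => j ->.
      by rewrite col_mxEu mxE normr0.
    by rewrite col_mxEd norm_coord_le.
  have uv_le : `|S' u - S' v| <= c2 * `|u - v| by rewrite -linearB.
  have e_le' : `|e| <= eps * (q * (c2 * `|u - v|)).
    rewrite (le_trans e_le)// ler_wpM2l ?(ltW eps0)//
      (le_trans (PB_le _ _ _))//.
    by rewrite ler_wpM2l// ltW.
  rewrite (@le_trans _ _ (c1 * (eps * (q * (c2 * `|u - v|)))))//.
    by rewrite ler_wpM2l ?(ltW c10)// (le_trans col_le).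
  rewrite /eps le_eqVlt; apply/orP; left; apply/eqP; field.
  by rewrite !gt_eqF// nat1r ltr0n.
(* The first term bounds the [mu] component of the field at [zeq], the second its [x] component: [f]
   vanishes at [p0] and grows with slope at most [|fu| + eps] in the input. *)
pose kk := kap + `|a| * kap * (`|fu| + eps).
have kk0 : 0 < kk by rewrite ltr_wpDr// !mulr_ge0// ?addr_ge0// ltW.
have F_le ref : `|ref - zeq| <= s -> `|F ref zeq| <= kk * `|ref - zeq|.
  move=> refs; have zs : `|zeq - zeq| <= s by rewrite subrr normr0 ltW.
  have afb : `|a * fb ref zeq| <= `|a| * kap * `|ref - zeq|.
    by rewrite normrM -mulrA ler_wpM2l.
  rewrite ge_max /=; apply/andP; split; last first.
    rewrite (le_trans (fb_le _ _))// ler_wpM2r// lerDl.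
    by rewrite !mulr_ge0// ?addr_ge0// ltW.
  have p0in : `|p0 - p0| < r1 by rewrite subrr normr0.
  have Pp0 : P ref zeq - p0 = (0, a * fb ref zeq).
    by rewrite -[LHS]/(zeq - zeq, a * fb ref zeq - 0) subrr subr0.
  have norm_Pp0 : `|P ref zeq - p0| = `|a * fb ref zeq|.
    by apply/eqP; rewrite Pp0 eq_le ge_max le_max /= normr0 normr_ge0 !lexx
      orbT.
  have := hr1 (P ref zeq) p0 (P_in _ _ zs refs) p0in.
  rewrite norm_Pp0 Pp0 (total_differential _ dfp) /= f_eq subr0 mulmx0 scale0r
    !add0r.
  set y := a * _ => f_le.
  have := ler_distD (y *: fu) (f xeq mueq y) 0; rewrite !subr0 => h.
  rewrite (le_trans h)// (le_trans (lerD f_le (lexx _)))//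
    (normrZ y) (mulrC eps) -mulrDr.
  rewrite (@le_trans _ _ (`|a| * kap * `|ref - zeq| * (eps + `|fu|)))//.
    by rewrite ler_wpM2r// addr_ge0// ltW.
  by rewrite (addrC eps) mulrAC ler_wpM2r// /kk lerDr ltW.
(* The second bound makes the field at [S zeq] at most [c1 * kk * d <= r / 2], as the fixed-point
   argument requires. *)
pose d := Num.min s (r / (2 * c1 * kk)).
have d0 : 0 < d by rewrite lt_min s0 divr_gt0// !mulr_gt0.
exists [set ref | `|ref - zeq| < d].
  by apply: (nbhs_normP zeq _).2; exists d => //= ref /=; rewrite distrC.
move=> ref /= refd.
have refs : `|ref - zeq| <= s by rewrite ltW// (lt_le_trans refd)// ge_min lexx.
have [|||zs zs_in [st rt]] := @near_diagonal_equilibrium _ _ (H ref) (S zeq)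
  (\row_i lam i) gamma r gamma_gt0 r0.
- by move=> i; rewrite mxE.
- by move=> u v uin vin; exact: H_near.
- rewrite /H SK (le_trans (S_le _))//.
  rewrite (@le_trans _ _ (c1 * (kk * `|ref - zeq|)))//.
    by rewrite ler_wpM2l ?(ltW c10)// F_le.
  have : `|ref - zeq| <= r / (2 * c1 * kk).
    by rewrite ltW// (lt_le_trans refd)// ge_min lexx orbT.
  by rewrite ler_pdivlMr ?mulr_gt0//; lra.
have HE w : H ref w = S (F ref (S' w)) by [].
exists (S' zs).
  suff : `|S' zs - zeq| < rV by rewrite distrC => /hV.
  rewrite -[zeq]SK -linearB (le_lt_trans (S'_le _))// mulrC.
  rewrite -ltr_pdivlMr// (le_lt_trans zs_in)//.
  apply: (@lt_le_trans _ _ r); first by move: r0; lra.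
  by rewrite ler_wpM2r ?invr_ge0 ?(ltW c20)// ge_min lexx orbT.
split.
  exact: (conj_stable_equilibrium c10 c20 S_le S'_le SK S'K HE st).
exact: (conj_reached_with_rate_gt c10 c20 S_le S'_le SK S'K HE rt).
Qed.
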